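(* Let $\Omega$ be a domain in $\mathbb{R}^N$, let $\mathscr{A}^{hk}(x)=\{a^{hk}_{ij}(x)\}$ ($1\le i,j\le m$, $1\le h,k\le N$) be $m\times m$ matrices with complex valued $L^\infty(\Omega)$ entries, let $A=\partial_h(\mathscr{A}^{hk}(x)\partial_k)$, and let $\varphi$ satisfy conditions (i)-(v) of the context. Suppose $\sup_{t>0}\Lambda^2(t)<1$. The operator $A$ is strict $L^\Phi$-dissipative if and only if there exists $\kappa>0$ such that $A-\kappa\Delta$ is $L^\Phi$-dissipative.
   Context: Conditions on $\varphi:(0,+\infty)\to(0,+\infty)$: (i) $\varphi\in C^1((0,+\infty))$; (ii) $(s\varphi(s))'>0$ for all $s>0$; (iii) the range of the strictly increasing function $s\varphi(s)$ is $(0,+\infty)$; (iv) there exist constants $C_1,C_2>0$, $r>-1$ and $s_0>0$ such that $C_1s^r\le(s\varphi(s))'\le C_2s^r$ for $s\in(0,s_0)$; if $r=0$ one requires moreover that the finite limit $\lim_{s\to0^+}\varphi(s)$ exists and is $>0$, and $\lim_{s\to0^+}s\varphi'(s)=0$; (v) there exists $s_1>s_0$ such that either $\varphi'(s)\ge0$ for all $s\ge s_1$ or $\varphi'(s)\le0$ for all $s\ge s_1$. The function $s\mapsto s\sqrt{\varphi(s)}$ is a strictly increasing bijection of $(0,+\infty)$; $\Lambda:(0,+\infty)\to\mathbb{R}$ is defined by $\Lambda(s\sqrt{\varphi(s)})=-\frac{s\varphi'(s)}{s\varphi'(s)+2\varphi(s)}$ for $s>0$. $\Phi(s)=\int_0^s\sigma\varphi(\sigma)d\sigma$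 is only used in the name ''$L^\Phi$-dissipative''. Summation over repeated indices is understood; $\langle\cdot,\cdot\rangle$ is the standard Hermitian inner product of $\mathbb{C}^m$. $\mathring{H}^1(\Omega)$ is the closure of the complex valued $C_c^\infty(\Omega)$ in the $H^1$ norm. $A=\partial_h(\mathscr{A}^{hk}\partial_k)$ is $L^\Phi$-dissipative if $\operatorname{Re}\int_\Omega\langle\mathscr{A}^{hk}\partial_ku,\partial_h(\varphi(|u|)u)\rangle dx\ge0$ for any $u\in[\mathring{H}^1(\Omega)]^m$ such that $\varphi(|u|)u\in[\mathring{H}^1(\Omega)]^m$; it is strict $L^\Phi$-dissipative if there exists $\kappa>0$ such that for all such $u$ the left-hand side is $\ge\kappa\int_\Omega|\nabla(\sqrt{\varphi(|u|)}\,u)|^2dx$ (with $\varphi(|u|)u$ and $\sqrt{\varphi(|u|)}\,u$ equal to $0$ where $u=0$). $A-\kappa\Delta$ denotes the operator with coefficient matrices $\mathscr{A}^{hk}-\kappa\,\delta_{hk}I$, $I$ the $m\times m$ identity. *)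

(* Defs.v *)
From HB Require Import structures.
From mathcomp Require Import all_boot all_order all_algebra.
From mathcomp Require Import all_classical all_reals all_analysis.
From mathcomp Require Import complex.
Set Implicit Arguments.
Unset Strict Implicit.
Unset Printing Implicit Defensive.
Import Order.TTheory GRing.Theory Num.Theory.
Import numFieldNormedType.Exports.
Local Open Scope classical_set_scope.
Local Open Scope ring_scope.
Local Open Scope complex_scope.

Definition rV_display : measure_display -> measure_display.
Proof. exact. Qed.

Section rV_measurable.
Variables (R : realType) (n : nat).

Let coors : 'I_n -> 'rV[R]_n -> R := fun i x => x ord0 i.

Let rV_set0 : g_sigma_preimage coors set0.
Proof. exact: sigma_algebra0. Qed.

Let rV_setC A : g_sigma_preimage coors A -> g_sigma_preimage coors (~` A).
Proof. exact: sigma_algebraC. Qed.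

Let rV_bigcup (F : (set 'rV[R]_n)^nat) :
  (forall i, g_sigma_preimage coors (F i)) ->
  g_sigma_preimage coors (\bigcup_i F i).
Proof. exact: sigma_algebra_bigcup. Qed.

(* The product sigma-algebra (as the library does for n.-tuple T), that is, the
   Borel sigma-algebra of R^n. *)
HB.instance Definition _ := @isMeasurable.Build
  (rV_display default_measure_display) 'rV[R]_n
  (g_sigma_preimage coors) rV_set0 rV_setC rV_bigcup.

End rV_measurable.

Section rV_measurable_lemmas.
Context d (T : measurableType d) (R : realType).

Lemma measurable_rVP n (f : T -> 'rV[R]_n) :
  measurable_fun [set: T] f <->
  forall i, measurable_fun [set: T] (fun x => f x ord0 i).
Proof.
apply: (@iff_trans _ (g_sigma_preimage
    (fun i => (fun v : 'rV[R]_n => v ord0 i) \o f) `<=` measurable)).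
  rewrite g_sigma_preimage_comp; split=> [mf A [/= C preC <-]|prefS].
    exact: mf.
  by move=> _ A mA; apply: prefS; exists A.
split=> [prefS i _ A mA|mf].
  apply: prefS; apply: sub_sigma_algebra.
  case: n i => [[] []//|n i] in f *.
  rewrite -bigcup_mkord_ord.
  exists i; first exact: ltn_ord.
  by exists A => //; rewrite inord_val.
apply: smallest_sub; first exact: sigma_algebra_measurable.
case: n => [|n] in f mf *; first by rewrite big_ord0.
rewrite -bigcup_mkord_ord; apply: bigcup_sub => i Ii.
by move=> A [B mB <-]; exact: mf.
Qed.

End rV_measurable_lemmas.

Lemma measurable_rV_coord (R : realType) n (i : 'I_n) :
  measurable_fun [set: 'rV[R]_n] (fun v : 'rV[R]_n => v ord0 i).
Proof. by apply/measurable_rVP: i; exact: measurable_id. Qed.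

Section lebesgue_rV_step.
Variables (R : realType) (n : nat).

Definition rV_cons (p : measurableTypeR R * 'rV[R]_n) : 'rV[R]_n.+1 :=
  row_mx (\row_(i < 1) p.1) p.2.

Lemma measurable_rV_cons : measurable_fun [set: measurableTypeR R * 'rV[R]_n] rV_cons.
Proof.
apply/measurable_rVP => i; rewrite /rV_cons.
have [j|j] := @split_ordP 1 n i => ->.
  rewrite (_ : (fun x => _) = fst); first exact: measurable_fst.
  by apply/funext => x; apply: etrans (row_mxEl _ _ _ _) _; rewrite mxE.
rewrite (_ : (fun x => _) = (fun v : 'rV[R]_n => v ord0 j) \o snd).
  apply: measurableT_comp; [exact: measurable_rV_coord|exact: measurable_snd].
by apply/funext => x; exact: row_mxEr.
Qed.

Variable mu : {sigma_finite_measure set 'rV[R]_n -> \bar R}.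

Definition lebesgue_rV_step : set 'rV[R]_n.+1 -> \bar R :=
  pushforward (@lebesgue_measure R \x mu)%E rV_cons.

Let measurable_rV_cons_preimage A : measurable A -> measurable (rV_cons @^-1` A).
Proof.
by move=> mA; rewrite -[X in measurable X]setTI; exact: measurable_rV_cons.
Qed.

Let lebesgue_rV_step0 : lebesgue_rV_step set0 = 0%E.
Proof. by rewrite /lebesgue_rV_step /pushforward preimage_set0 measure0. Qed.

Let lebesgue_rV_step_ge0 A : (0 <= lebesgue_rV_step A)%E.
Proof. by rewrite /lebesgue_rV_step /pushforward; exact: measure_ge0. Qed.

Let lebesgue_rV_step_sigma_additive : semi_sigma_additive lebesgue_rV_step.
Proof.
move=> F mF tF mUF; rewrite /lebesgue_rV_step /pushforward preimage_bigcup.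
apply: measure_semi_sigma_additive.
- by move=> k; exact: measurable_rV_cons_preimage.
- apply/trivIsetP => /= i j _ _ ij; rewrite -preimage_setI.
  by move/trivIsetP : tF => /(_ _ _ _ _ ij) ->//; rewrite preimage_set0.
- by rewrite -preimage_bigcup; exact: measurable_rV_cons_preimage.
Qed.

HB.instance Definition _ := isMeasure.Build _ _ _ lebesgue_rV_step
  lebesgue_rV_step0 lebesgue_rV_step_ge0 lebesgue_rV_step_sigma_additive.

Let lebesgue_rV_step_sigma_finite :
  sigma_finite [set: 'rV[R]_n.+1] lebesgue_rV_step.
Proof.
have /sigma_finiteP[F [TF ndF Foo]] := sigma_finiteT (@lebesgue_measure R).
have /sigma_finiteP[G [TG ndG Goo]] := sigma_finiteT mu.
pose uncons (v : 'rV[R]_(1 + n)) : measurableTypeR R * 'rV[R]_n := (lsubmx v ord0 ord0, rsubmx v).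
have consK : cancel rV_cons uncons.
  move=> [x v]; rewrite /uncons /rV_cons /=.
  by rewrite row_mxKl row_mxKr mxE.
have unconsK : cancel uncons rV_cons.
  move=> v; rewrite /uncons /rV_cons /= -[RHS]hsubmxK; congr row_mx.
  by apply/rowP => i; rewrite mxE (ord1 i).
have munc : measurable_fun [set: 'rV[R]_n.+1] (uncons : 'rV[R]_n.+1 -> _).
  apply/measurable_fun_pairP; split => /=.
    rewrite (_ : _ \o _ = (fun v : 'rV[R]_n.+1 => v ord0 (lshift n ord0 : 'I_(1 + n)))).
      exact: measurable_rV_coord.
    by apply/funext => v /=; rewrite mxE.
  apply/measurable_rVP => i.
  rewrite (_ : (fun x => _) = (fun v : 'rV[R]_n.+1 => v ord0 (rshift 1 i : 'I_(1 + n)))).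
    exact: measurable_rV_coord.
  by apply/funext => v /=; rewrite mxE.
exists (fun k => uncons @^-1` (F k `*` G k)).
  rewrite -preimage_bigcup -[LHS](preimage_setT uncons); congr (_ @^-1` _).
  rewrite -setXTT TF TG predeqE => -[x y]; split.
    move=> [/= [i _ Fix] [j _ Gjy]]; exists (maxn i j) => //; split.
    - by move: x Fix; exact/subsetPset/ndF/leq_maxl.
    - by move: y Gjy; exact/subsetPset/ndG/leq_maxr.
  by move=> [i _ [/= ? ?]]; split; exists i.
move=> k; have [mF Fkoo] := Foo k; have [mG Gkoo] := Goo k; split.
  by rewrite -[X in measurable X]setTI; apply: munc => //; exact: measurableX.
rewrite /lebesgue_rV_step /pushforward -comp_preimage.
rewrite (_ : _ \o _ = id); last by apply/funext => x /=; exact: consK.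
by rewrite preimage_id product_measure1E// lte_mul_pinfty// ge0_fin_numE.
Qed.

HB.instance Definition _ :=
  Measure_isSigmaFinite.Build _ _ _ lebesgue_rV_step lebesgue_rV_step_sigma_finite.

End lebesgue_rV_step.

Fixpoint lebesgue_rV (R : realType) (n : nat) :
    {sigma_finite_measure set 'rV[R]_n -> \bar R} :=
  match n with
  | 0 => \d_(0 : 'rV[R]_0)
  | n'.+1 => lebesgue_rV_step (lebesgue_rV R n')
  end.

Lemma rV_cons0 (R : realType) n (p : measurableTypeR R * 'rV[R]_n) :
  rV_cons p ord0 ord0 = p.1.
Proof.
rewrite (_ : ord0 = lshift n ord0 :> 'I_(1 + n)); last exact: val_inj.
by apply: etrans (row_mxEl _ _ _ _) _; rewrite mxE.
Qed.

Lemma rV_consS (R : realType) n (p : measurableTypeR R * 'rV[R]_n) (i : 'I_n) :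
  rV_cons p ord0 (lift ord0 i) = p.2 ord0 i.
Proof.
rewrite (_ : lift ord0 i = rshift 1 i :> 'I_(1 + n)); last exact: val_inj.
exact: row_mxEr.
Qed.

Lemma measurable_rV_box (R : realType) n (B : 'I_n -> set R) :
  (forall i, measurable (B i)) ->
  measurable [set v : 'rV[R]_n | forall i, B i (v ord0 i)].
Proof.
move=> mB; rewrite (_ : mkset _ =
    \bigcap_(i in [set: 'I_n]) ((fun v : 'rV[R]_n => v ord0 i) @^-1` B i)).
  apply: fin_bigcap_measurable => [|i _]; first exact: finite_finset.
  by rewrite -[X in measurable X]setTI; apply: (measurable_rV_coord i) => //; exact: mB.
by apply/seteqP; split => v /= Bv i; [move=> _|]; exact: Bv.
Qed.

Lemma lebesgue_rV_box (R : realType) n (B : 'I_n -> set (measurableTypeR R)) :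
  (forall i, measurable (B i)) ->
  lebesgue_rV R n [set v | forall i, B i (v ord0 i)] =
  (\prod_(i < n) lebesgue_measure (B i))%E.
Proof.
elim: n B => [|n IHn] B mB /=.
  by rewrite big_ord0 diracE mem_set// => -[].
rewrite big_ord_recl -IHn => [|i]; last exact: mB.
rewrite -product_measure1E;
  [|exact: mB|apply: (@measurable_rV_box R n (B \o lift ord0)) => i; exact: mB].
rewrite /lebesgue_rV_step /pushforward; congr (product_measure1 _ _ _).
apply/seteqP; split => -[x v] /= => [Bxv|[Bx Bv] i].
  split=> [|i]; first by have := Bxv ord0; rewrite rV_cons0.
  by have := Bxv (lift ord0 i); rewrite rV_consS.
have [j ->|->] := unliftP ord0 i; first by rewrite rV_consS; exact: Bv.
by rewrite rV_cons0.
Qed.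

Record phi_conditions (R : realType) (phi : R -> R) : Prop := {
  phi_gt0 : forall s : R, 0 < s -> 0 < phi s;
  phi_derivable : forall s : R, 0 < s -> derivable phi s 1;
  phi_derive_continuous : forall s : R, 0 < s -> {for s, continuous (derive1 phi)};
  phi_incr : forall s : R, 0 < s -> 0 < derive1 (fun t => t * phi t) s;
  phi_range : [set s * phi s | s in [set s : R | 0 < s]] = [set t : R | 0 < t];
  phi_growth : exists C1 C2 r s0 : R,
    [/\ [/\ 0 < C1, 0 < C2, -1 < r & 0 < s0],
        forall s : R, 0 < s < s0 ->
          C1 * s `^ r <= derive1 (fun t => t * phi t) s <= C2 * s `^ r,
        r = 0 ->
          (exists2 l : R, 0 < l & phi s @[s --> 0^'+] --> l) /\
          s * derive1 phi s @[s --> 0^'+] --> (0 : R)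
      & exists2 s1 : R, s0 < s1 &
          (forall s : R, s1 <= s -> 0 <= derive1 phi s) \/
          (forall s : R, s1 <= s -> derive1 phi s <= 0)] }.

(* This determines [Lambda] on the positive half-line, because
   [s |-> s * sqrt (phi s)] maps the positive half-line bijectively to itself. *)
Definition is_Lambda (R : realType) (phi Lambda : R -> R) : Prop :=
  forall s : R, 0 < s ->
    Lambda (s * Num.sqrt (phi s)) =
      - (s * derive1 phi s / (s * derive1 phi s + 2 * phi s)).

Section complex_functions.
Variables (R : realType) (N : nat).
Implicit Types (D Omega : set 'rV[R]_N) (f g psi : 'rV[R]_N -> R[i]).

Definition domain Omega : Prop := [/\ open Omega, connected Omega & Omega !=set0].

Definition cmeasurable D f : Prop :=
  measurable_fun D (fun x => complex.Re (f x)) /\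
  measurable_fun D (fun x => complex.Im (f x)).

Definition cintegral D f : R[i] :=
  (\int[lebesgue_rV R N]_(x in D) complex.Re (f x)) +i*
  (\int[lebesgue_rV R N]_(x in D) complex.Im (f x)).

Definition sqL2norm D f : \bar R :=
  (\int[lebesgue_rV R N]_(x in D) (Normc.normc (f x) ^+ 2)%:E)%E.

Definition L2 D f : Prop := cmeasurable D f /\ (sqL2norm D f < +oo)%E.

Definition Linfty D f : Prop :=
  cmeasurable D f /\
  exists M : R, {ae lebesgue_rV R N, forall x, D x -> Normc.normc (f x) <= M}.

Definition pderiv (k : 'I_N) (a : 'rV[R]_N -> R) : 'rV[R]_N -> R :=
  'D_(delta_mx ord0 k) a.

(* C^infty: all iterated partial derivatives exist and are continuous. *)
Definition smooth (a : 'rV[R]_N -> R) : Prop := forall s : seq 'I_N,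
  continuous (foldr pderiv a s) /\
  forall (k : 'I_N) x, derivable (foldr pderiv a s) x (delta_mx ord0 k).

Definition cpderiv (k : 'I_N) psi : 'rV[R]_N -> R[i] := fun x =>
  pderiv k (fun y => complex.Re (psi y)) x +i*
  pderiv k (fun y => complex.Im (psi y)) x.

Definition Cc_infty Omega psi : Prop :=
  [/\ smooth (fun x => complex.Re (psi x)),
      smooth (fun x => complex.Im (psi x)) &
      exists K, [/\ compact K, K `<=` Omega & forall x, ~ K x -> psi x = 0]].

Definition weak_pderiv Omega (k : 'I_N) f g : Prop := forall psi,
  Cc_infty Omega psi ->
  cintegral Omega (fun x => f x * cpderiv k psi x) =
    - cintegral Omega (fun x => g x * psi x).

(* f belongs to H^1(Omega) and df is its weak gradient. *)
Definition H1_grad Omega f (df : 'I_N -> 'rV[R]_N -> R[i]) : Prop :=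
  L2 Omega f /\ forall k, L2 Omega (df k) /\ weak_pderiv Omega k f (df k).

Definition sqH1norm Omega f (df : 'I_N -> 'rV[R]_N -> R[i]) : \bar R :=
  (sqL2norm Omega f + \sum_(k < N) sqL2norm Omega (df k))%E.

(* f belongs to the closure of C_c^infty(Omega) in H^1(Omega) and df is its
   weak gradient. *)
Definition H10_grad Omega f (df : 'I_N -> 'rV[R]_N -> R[i]) : Prop :=
  H1_grad Omega f df /\
  exists psi : nat -> 'rV[R]_N -> R[i],
    (forall n, Cc_infty Omega (psi n)) /\
    (sqH1norm Omega (fun x => psi n x - f x)
       (fun k x => cpderiv k (psi n) x - df k x) @[n --> \oo] --> 0%E).

End complex_functions.

Section dissipativity.
Variables (R : realType) (N m : nat).
Implicit Types (Omega : set 'rV[R]_N) (u : 'rV[R]_N -> 'cV[R[i]]_m)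
  (du dw : 'I_N -> 'rV[R]_N -> 'cV[R[i]]_m)
  (A : 'I_N -> 'I_N -> 'rV[R]_N -> 'M[R[i]]_m).

Definition hdot (v w : 'cV[R[i]]_m) : R[i] :=
  \sum_(i < m) v i ord0 * conjc (w i ord0).

Definition cvnorm (v : 'cV[R[i]]_m) : R := Num.sqrt (complex.Re (hdot v v)).

Definition vH1_grad Omega u du : Prop := forall i : 'I_m,
  H1_grad Omega (fun x => u x i ord0) (fun k x => du k x i ord0).

Definition vH10_grad Omega u du : Prop := forall i : 'I_m,
  H10_grad Omega (fun x => u x i ord0) (fun k x => du k x i ord0).

(* The function rho(|u|) u; it vanishes where u does, whatever rho 0 is. *)
Definition radial_scale (rho : R -> R) u : 'rV[R]_N -> 'cV[R[i]]_m :=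
  fun x => (rho (cvnorm (u x)))%:C *: u x.

Definition diss_form Omega A du dw : R :=
  complex.Re (cintegral Omega (fun x =>
    \sum_(h < N) \sum_(k < N) hdot (A h k x *m du k x) (dw h x))).

Definition LPhi_dissipative Omega A (phi : R -> R) : Prop :=
  forall u du dw,
    vH10_grad Omega u du -> vH10_grad Omega (radial_scale phi u) dw ->
    0 <= diss_form Omega A du dw.

(* The weak gradient of sqrt(phi(|u|)) u is required to exist as an L^2
   function: the right-hand side of the inequality presupposes it. *)
Definition strict_LPhi_dissipative Omega A (phi : R -> R) : Prop :=
  exists2 kappa : R, 0 < kappa & forall u du dw,
    vH10_grad Omega u du -> vH10_grad Omega (radial_scale phi u) dw ->
    exists2 dz, vH1_grad Omega (radial_scale (fun s => Num.sqrt (phi s)) u) dz &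
      (kappa%:E * \int[lebesgue_rV R N]_(x in Omega)
                    (\sum_(k < N) cvnorm (dz k x) ^+ 2)%:E
       <= (diss_form Omega A du dw)%:E)%E.

(* The coefficients of A - kappa Delta. *)
Definition sub_laplacian A (kappa : R) :
    'I_N -> 'I_N -> 'rV[R]_N -> 'M[R[i]]_m :=
  fun h k x => A h k x - ((kappa * (h == k)%:R)%:C)%:M.

End dissipativity.

(* Main.v *)
(** With V(u) = sqrt(phi |u|) u and W(u) = phi(|u|) u, the theorem reduces to the
    existence of a weak gradient of V(u) in L^2 and to the pointwise bounds
      delta |DV(u)|^2 <= Re <Du, DW(u)> <= |DV(u)|^2,  delta = 1 - sup Lambda^2.
    Instead of a chain rule, which phi is too singular at 0 and at infinity to
    give directly, these are obtained from difference quotients: for vectors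
    a, b one has the identity
      |V a - V b|^2 - <a - b, W a - W b> = (sqrt(phi |a|) - sqrt(phi |b|))^2 <a, b>
    and the monotonicity delta |V a - V b|^2 <= <a - b, W a - W b>, so
    the difference quotients of V(u) are dominated by those of u and W(u).  The
    latter converge strongly in L^2, because u and W(u) are limits of test
    functions.  Along a subsequence they converge almost everywhere under an
    integrable majorant; the quotients of V(u) then converge too and dominated
    convergence yields the weak gradient.  In the direction from strict
    dissipativity the weak gradient is given abstractly, and it is identified
    with the constructed one by the fundamental lemma of the calculus of
    variations. *)

Require Import Defs.
From HB Require Import structures.
From mathcomp Require Import all_boot all_order all_algebra.
From mathcomp Require Import all_classical all_reals all_analysis.
From mathcomp Require Import measurable_realfun complex.
From mathcomp Require Import ring lra.
Set Implicit Arguments.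
Unset Strict Implicit.
Unset Printing Implicit Defensive.
Import Order.TTheory GRing.Theory Num.Theory.
Import numFieldNormedType.Exports.
Local Open Scope classical_set_scope.
Local Open Scope ring_scope.

(** Write rho for the square root of [phi]. As (s rho)' = (2 phi + s phi') / (2 rho), the hypothesis
    [elliptic] below reads delta ((s rho)')^2 <= (s phi)', and it restates delta <= 1 - Lambda^2.
    The monotonicity of the vector maps is its integrated form. The difficulty is that V(u) comes
    with no approximating test functions: whatever is known about its quotients must follow
    pointwise from those of u and W(u). Hence the lower bound is proved for arbitrary pairs of
    vectors, and it also supplies the majorant. The upper bound may fail for pairs with <a, b> < 0
    and is recovered only in the limit, where b tends to a. Where u = 0 the map V need not be
    differentiable, and the limit of its quotients exists because those of W(u) converge. Membership
    in H^1_0, rather than H^1, permits extension by zero, so that translations act on the whole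
    space; for V(u) only H^1 is obtained. The two bounds serve opposite directions: the upper one
    leads from strict dissipativity to A - kappa Delta with the same kappa, the lower one returns
    with kappa delta in place of kappa. *)

Lemma cvg_diff_quotient_comp (R : realType) (F : R -> R) (y l r : R) (yn h : nat -> R) :
  is_derive y 1 F l -> (forall n, h n != 0) -> h n @[n --> \oo] --> 0 ->
  (yn n - y) / h n @[n --> \oo] --> r ->
  (F (yn n) - F y) / h n @[n --> \oo] --> l * r.
Proof.
move=> dF h0 hcvg ycvg.
(* The increments [yn n - y] may vanish, so the quotient of [F] is completed at 0 by the value of
   the derivative; the completed quotient is continuous there. *)
pose g (t : R) : R := if t == 0 then l else (F (y + t) - F y) / t.
have gE t : F (y + t) - F y = g t * t.
  rewrite /g; have [->|t0] := eqVneq t 0; first by rewrite addr0 subrr mulr0.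
  by rewrite mulfVK.
have gc : g x @[x --> (0 : R)] --> g 0.
  apply/continuous_withinNx.
  rewrite {2}/g eqxx.
  have [dFy <-] := dF.
  apply: cvg_trans dFy; apply: near_eq_cvg; near=> t.
  rewrite /g ifF.
    by rewrite /GRing.scale/= mulr1 (addrC y) mulrC.
  by apply/negbTE; near: t; exact: nbhs_dnbhs_neq.
have y0 : yn n - y @[n --> \oo] --> 0.
  have -> : (fun n => yn n - y) = (fun n => (yn n - y) / h n * h n).
    by apply/funext => n; rewrite mulfVK.
  by rewrite -(mulr0 r); exact: cvgM.
have -> : (fun n => (F (yn n) - F y) / h n) =
    (fun n => g (yn n - y) * ((yn n - y) / h n)).
  by apply/funext => n; rewrite mulrA -gE (addrC y) subrK.
have -> : l = g 0 by rewrite /g eqxx.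
by apply: cvgM => //; exact: (cvg_comp _ _ y0 gc).
Unshelve. all: by end_near. Qed.

(** * Monotonicity of the radial maps: the scalar inequality *)

Section radial_maps.
Context {R : realType} (phi : R -> R) (delta : R).
Hypothesis phi0 : forall s : R, 0 < s -> 0 < phi s.
Hypothesis phi' : forall s : R, 0 < s -> derivable phi s 1.
Hypothesis delta01 : 0 < delta <= 1.
Hypothesis elliptic : forall s : R, 0 < s ->
  delta * (2 * phi s + s * derive1 phi s) ^+ 2 <= 4 * phi s * (phi s + s * derive1 phi s).

Implicit Types s t : R.
Let rho (s : R) : R := Num.sqrt (phi s).

Lemma rho_gt0 s : 0 < s -> 0 < rho s.
Proof. by move=> s0; rewrite sqrtr_gt0 phi0. Qed.

Lemma is_derive_phi s : 0 < s -> is_derive s 1 phi (derive1 phi s).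
Proof. by move=> s0; rewrite derive1E; apply: DeriveDef => //; exact: phi'. Qed.

Lemma is_derive_rho s : 0 < s ->
  is_derive s 1 rho (derive1 phi s / (2 * rho s)).
Proof.
move=> s0; have := is_derive1_sqrt (phi0 s0) => h.
have := @is_derive1_comp _ Num.sqrt phi s _ _ h (is_derive_phi s0).
by rewrite /rho /comp => h2; apply: (is_derive_eq h2); rewrite mulrC.
Qed.


(** This is the Cauchy-Schwarz inequality for the integral of (x rho)' over [t, s], combined with
    delta ((x rho)')^2 <= (x phi)'. The mean value theorem, applied to a function with a free
    parameter, replaces the integral. *)
Lemma radial_monotone1 t s : 0 < t -> t < s ->
  delta * (s * rho s - t * rho t) ^+ 2 <= (s - t) * (s * phi s - t * phi t).
Proof.
move=> t0 ts; set z := _ - t * rho t; set w := _ - t * phi t; set p := s - t.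
have p0 : 0 < p by rewrite subr_gt0.
have [d0 d1] := andP delta01.
pose c := Num.sqrt delta.
have c2 : c ^+ 2 = delta by rewrite sqr_sqrtr// ltW.
have c0 : 0 < c by rewrite sqrtr_gt0.
(* AM-GM with a free weight [l], chosen optimally at the end; the sign [e]
   spares a proof that [x * rho x] increases. *)
have key (e l : R) : e ^+ 2 = 1 -> 0 < l -> 2 * e * c * z * l <= l ^+ 2 * p + w.
  move=> e1 l0.
  pose f (x : R) : R := (l * x + x * phi x / l) / 2 - e * c * (x * rho x).
  pose df (x : R) : R := (l + (phi x + x * derive1 phi x) / l) / 2
               - e * c * (rho x + x * (derive1 phi x / (2 * rho x))).
  have fdf (x : R) : 0 < x -> is_derive x 1 f (df x).
    move=> x0; have h1 := is_derive_phi x0; have h2 := is_derive_rho x0.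
    rewrite /f /df; apply: is_derive_eq.
    rewrite /GRing.scale /=; field.
    by rewrite (gt_eqF l0) gt_eqF// rho_gt0.
  have df0 (x : R) : 0 < x -> 0 <= df x.
    move=> x0; have r0 := rho_gt0 x0.
    have r2 : rho x ^+ 2 = phi x by rewrite sqr_sqrtr// ltW// phi0.
    have := elliptic x0; rewrite -r2 -c2 => ell.
    set dp := derive1 phi x in ell *.
    rewrite /df -/dp -r2.
    have -> : (l + (rho x ^+ 2 + x * dp) / l) / 2
               - e * c * (rho x + x * (dp / (2 * rho x))) =
      (4 * rho x ^+ 2 * l ^+ 2 + 4 * rho x ^+ 2 * (rho x ^+ 2 + x * dp)
        - 4 * e * c * l * rho x * (2 * rho x ^+ 2 + x * dp))
      / (8 * l * rho x ^+ 2).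
      field; by rewrite (gt_eqF l0) gt_eqF.
    apply: divr_ge0; last by rewrite !mulr_ge0// ?exprn_ge0 // ltW.
    set m := 2 * rho x ^+ 2 + x * dp in ell *.
    (* Ellipticity bounds 4 rho^2 (rho^2 + x phi') below by (c m)^2, which completes the square in
       the numerator. *)
    apply: (@le_trans _ _ ((2 * rho x * l - e * c * m) ^+ 2)); first exact: sqr_ge0.
    rewrite sqrrB.
    have -> : (e * c * m) ^+ 2 = c ^+ 2 * m ^+ 2 by rewrite !exprMn e1 mul1r.
    by move: ell; lra.
  have fc : {within `[t, s], continuous f}.
    apply: derivable_within_continuous => x; rewrite in_itv/= => /andP[tx _].
    by have [] := fdf x (lt_le_trans t0 tx).
  have [x] := @MVT R f df t s ts
     (fun x xI => fdf x (lt_trans t0 (andP (xI : t < x < s)).1)) fc.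
  rewrite in_itv/= => /andP[tx xs] fE.
  have : 0 <= f s - f t.
    rewrite fE; apply: mulr_ge0; last by rewrite subr_ge0 ltW.
    by apply: df0; exact: lt_trans tx.
  have -> : f s - f t = (l ^+ 2 * p + w - 2 * e * c * z * l) / (2 * l).
    by rewrite /f /z /w /p; field; rewrite gt_eqF.
  by rewrite pmulr_lge0 ?subr_ge0// invr_gt0 mulr_gt0.
(* Adding [key] for both signs removes [z] and leaves 0 <= l^2 p + w for every l > 0. If w < 0, the
   choice l^2 = - w / (2 p) turns this into 0 <= w / 2. *)
have w0 : 0 <= w.
  rewrite leNgt; apply/negP => w0.
  pose l := Num.sqrt (- w / (2 * p)).
  have l0 : 0 < l by rewrite sqrtr_gt0 divr_gt0 ?mulr_gt0 ?oppr_gt0.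
  have h1 := key 1 l (expr1n _ _) l0.
  have h2 := key (-1) l (etrans (sqrrN 1) (expr1n _ _)) l0.
  have : 0 <= l ^+ 2 * p + w by move: h1 h2; lra.
  rewrite sqr_sqrtr; last by rewrite ltW// divr_gt0 ?mulr_gt0 ?oppr_gt0.
  have -> : - w / (2 * p) * p + w = w / 2 by field; rewrite gt_eqF.
  by move: w0; lra.
have [->|z0] := eqVneq z 0; first by rewrite expr0n/= mulr0 mulr_ge0// ltW.
(* This is the minimum point of l^2 p - 2 c |z| l + w, where [key] becomes delta z^2 <= p w. *)
pose l := c * `|z| / p.
have l0 : 0 < l by rewrite divr_gt0// mulr_gt0// normr_gt0.
have := key (Num.sg z) l _ l0; rewrite sqr_sg z0 => /(_ erefl).
have -> : 2 * Num.sg z * c * z * l = 2 * (delta * z ^+ 2) / p.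
  rewrite /l -c2 -(real_normK (num_real z)); have := normrEsg z.
  set n := `|z| => nE.
  have -> : 2 * Num.sg z * c * z * (c * n / p) = 2 * c ^+ 2 * (Num.sg z * z) * n / p.
    by field; rewrite gt_eqF.
  by rewrite -nE; field; rewrite gt_eqF.
have -> : l ^+ 2 * p + w = (delta * z ^+ 2 + p * w) / p.
  by rewrite /l -c2 -(real_normK (num_real z)); field; rewrite gt_eqF.
by rewrite ler_pM2r ?invr_gt0//; lra.
Qed.

(** * Monotonicity and difference quotients of the radial maps on vectors *)

Section vectors.
Variable I : finType.
Implicit Types a b p w : I -> R.

Definition ip a b : R := \sum_i a i * b i.
Definition nrm a : R := Num.sqrt (ip a a).
Definition radial (f : R -> R) a : I -> R := fun i => f (nrm a) * a i.

Lemma ip_ge0 a : 0 <= ip a a.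
Proof. by apply: sumr_ge0 => i _; rewrite -expr2 sqr_ge0. Qed.

Lemma nrm_ge0 a : 0 <= nrm a. Proof. exact: sqrtr_ge0. Qed.

Lemma sqr_nrm a : nrm a ^+ 2 = ip a a.
Proof. by rewrite sqr_sqrtr// ip_ge0. Qed.

Lemma ipC a b : ip a b = ip b a.
Proof. by apply: eq_bigr => i _; rewrite mulrC. Qed.

Lemma ipZl k a b : ip (fun i => k * a i) b = k * ip a b.
Proof. by rewrite /ip mulr_sumr; apply: eq_bigr => i _; rewrite mulrA. Qed.

Lemma ipBl a b c : ip (a \- b) c = ip a c - ip b c.
Proof. by rewrite -sumrB; apply: eq_bigr => i _; rewrite /= mulrBl. Qed.

Lemma ipBr a b c : ip c (a \- b) = ip c a - ip c b.
Proof. by rewrite ipC ipBl !(ipC _ c). Qed.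

Lemma ipZr k a b : ip b (fun i => k * a i) = k * ip b a.
Proof. by rewrite ipC ipZl ipC. Qed.

Lemma nrm_eq0 a : nrm a = 0 -> forall i, a i = 0.
Proof.
move=> a0 i; have : ip a a == 0 by rewrite -sqr_nrm a0 expr0n.
rewrite psumr_eq0 => [/allP/(_ i)|j _]; last by rewrite -expr2 sqr_ge0.
by rewrite mem_index_enum => /(_ isT); rewrite mulf_eq0 orbb => /eqP.
Qed.

Lemma ip_le_nrm a b : ip a b <= nrm a * nrm b.
Proof.
have [/nrm_eq0 a0|a0] := eqVneq (nrm a) 0.
  rewrite /ip big1 => [|i _]; last by rewrite a0 mul0r.
  by rewrite mulr_ge0// nrm_ge0.
have [/nrm_eq0 b0|b0] := eqVneq (nrm b) 0.
  rewrite /ip big1 => [|i _]; last by rewrite b0 mulr0.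
  by rewrite mulr_ge0// nrm_ge0.
have := ip_ge0 ((fun i => nrm b * a i) \- (fun i => nrm a * b i)).
rewrite ipBl !ipBr !ipZl !ipZr (ipC b a) -!sqr_nrm => h.
have ab0 : 0 < 2 * (nrm a * nrm b) by rewrite !mulr_gt0// lt_def ?a0 ?b0 nrm_ge0.
rewrite -(ler_pM2l ab0); move: h; set x := nrm a; set y := nrm b; nra.
Qed.

Lemma ip_le_sqr a b : ip a b <= (ip a a + ip b b) / 2.
Proof.
have := ip_ge0 (a \- b); rewrite ipBl !ipBr (ipC b a); lra.
Qed.

(** In both terms on the left the contributions of <a, a> and <b, b> are phi(|a|) |a|^2 and phi(|b|)
    |b|^2, and they cancel. The multiples of <a, b> that remain form a square, so the sign of the
    difference is governed by that of <a, b>. *)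
Lemma radial_identity a b :
  ip (radial rho a \- radial rho b) (radial rho a \- radial rho b)
  - ip (a \- b) (radial phi a \- radial phi b)
  = (rho (nrm a) - rho (nrm b)) ^+ 2 * ip a b.
Proof.
(* Nothing is known about [phi 0], so rho^2 = phi may fail at 0; there the factor [ip c d]
   vanishes. *)
have rho2 c d : rho (nrm c) ^+ 2 * ip c d = phi (nrm c) * ip c d.
  have [/nrm_eq0 c0|c0] := eqVneq (nrm c) 0.
    by rewrite /ip big1 ?mulr0// => i _; rewrite c0 mul0r.
  by rewrite sqr_sqrtr// ltW// phi0// lt_def c0 nrm_ge0.
rewrite !ipBl !ipBr /radial !ipZl !ipZr (ipC b a).
have := rho2 a a; have := rho2 b b; have := rho2 a b; have := rho2 b a.
by rewrite (ipC b a); lra.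
Qed.

(** If <a, b> <= 0, [radial_identity] gives the bound even with 1 in place of delta. If <a, b> > 0,
    the norms are kept fixed: the inequality is affine in <a, b>, and the extreme value |a| |b| is
    the case of parallel vectors, that is, the scalar inequality. *)
Lemma radial_monotone a b :
  delta * ip (radial rho a \- radial rho b) (radial rho a \- radial rho b)
  <= ip (a \- b) (radial phi a \- radial phi b).
Proof.
have [d0 d1] := andP delta01.
set z := ip (radial rho a \- _) _; set w := ip (a \- b) _.
have zw : z - w = (rho (nrm a) - rho (nrm b)) ^+ 2 * ip a b.
  exact: radial_identity.
have z0 : 0 <= z by exact: ip_ge0.
have [ab0|ab0] := leP (ip a b) 0.
  have : z - w <= 0 by rewrite zw mulr_ge0_le0// sqr_ge0.
  have : 0 <= z * (1 - delta) by rewrite mulr_ge0// subr_ge0.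
  by lra.
have [a0|a0] := eqVneq (nrm a) 0.
  by move: ab0; rewrite /ip big1 ?ltxx// => i _; rewrite (nrm_eq0 a0) mul0r.
have [b0|b0] := eqVneq (nrm b) 0.
  by move: ab0; rewrite /ip big1 ?ltxx// => i _; rewrite (nrm_eq0 b0) mulr0.
have s0 : 0 < nrm a by rewrite lt_def a0 nrm_ge0.
have t0 : 0 < nrm b by rewrite lt_def b0 nrm_ge0.
have h1 : delta * (nrm a * rho (nrm a) - nrm b * rho (nrm b)) ^+ 2 <=
    (nrm a - nrm b) * (nrm a * phi (nrm a) - nrm b * phi (nrm b)).
  have [ab|ba|->] := ltgtP (nrm a) (nrm b); last by rewrite !subrr expr0n mulr0 mul0r.
    by have := radial_monotone1 s0 ab; lra.
  by have := radial_monotone1 t0 ba; lra.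
have abst := ip_le_nrm a b.
have zE : z = (nrm a * rho (nrm a)) ^+ 2 + (nrm b * rho (nrm b)) ^+ 2
    - 2 * rho (nrm a) * rho (nrm b) * ip a b.
  rewrite /z !ipBl !ipBr /radial !ipZl !ipZr (ipC b a) -!sqr_nrm; ring.
suff : (rho (nrm a) - rho (nrm b)) ^+ 2 * ip a b <= (1 - delta) * z.
  by rewrite -zw; lra.
have rs : rho (nrm a) ^+ 2 = phi (nrm a) by rewrite sqr_sqrtr// ltW// phi0.
have rt : rho (nrm b) ^+ 2 = phi (nrm b) by rewrite sqr_sqrtr// ltW// phi0.
rewrite zE; move: h1 ab0 abst s0 t0; rewrite -rs -rt.
set s := nrm a; set t := nrm b; set c := ip a b; set x := rho s; set y := rho t.
move=> h1 c0 cst s0 t0.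
(* The claim now reads B c <= D for 0 < c <= s t. It holds at c = s t by the scalar inequality and
   near c = 0 since D >= 0; the sign of B decides which of the two is used. *)
pose B := (x - y) ^+ 2 + (1 - delta) * 2 * x * y.
pose D := (1 - delta) * ((s * x) ^+ 2 + (t * y) ^+ 2).
have D0 : 0 <= D by rewrite mulr_ge0 ?subr_ge0// addr_ge0// sqr_ge0.
have BD : B * (s * t) <= D by rewrite /B /D; move: h1; lra.
suff : B * c <= D by rewrite /B /D; lra.
have [B0|B0] := leP B 0; first by apply: le_trans D0; rewrite mulr_le0_ge0// ltW.
by apply: le_trans BD; rewrite ler_pM2l.
Qed.

Lemma cvg_ip (an bn : nat -> I -> R) p w :
  (forall i, an n i @[n --> \oo] --> p i) ->
  (forall i, bn n i @[n --> \oo] --> w i) ->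
  ip (an n) (bn n) @[n --> \oo] --> ip p w.
Proof.
move=> ap bw; rewrite /ip.
by apply: cvg_big => [x|i _]; [exact: add_continuous|exact: cvgM].
Qed.

(** Away from 0 this is the product rule; the scalar factor is regarded as a function of [ip a a],
    whose quotients are bilinear in the data and converge by [cvg_ip]. At a = 0 no derivative of the
    map is available, and the hypothesis on the quotients of [radial phi] does the work. *)
Lemma radial_cvg_diff_quotient a (an : nat -> I -> R) (h : nat -> R) p w :
  (forall n, h n != 0) -> h n @[n --> \oo] --> 0 ->
  (forall i, (an n i - a i) / h n @[n --> \oo] --> p i) ->
  (forall i, (radial phi (an n) i - radial phi a i) / h n @[n --> \oo] --> w i) ->
  exists z : I -> R, forall i,
    (radial rho (an n) i - radial rho a i) / h n @[n --> \oo] --> z i.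
Proof.
move=> h0 hcvg ap bw.
have ana i : an n i @[n --> \oo] --> a i.
  have -> : (fun n => an n i) = (fun n => (an n i - a i) / h n * h n + a i).
    by apply/funext => n; rewrite mulfVK// subrK.
  rewrite -[X in _ --> X]add0r; apply: cvgD; last exact: cvg_cst.
  by rewrite -(mulr0 (p i)); exact: cvgM.
have [a0|a0] := eqVneq (nrm a) 0; last first.
  have ga0 : 0 < nrm a by rewrite lt_def a0 nrm_ge0.
  pose F (y : R) : R := rho (Num.sqrt y).
  have ipa0 : 0 < ip a a by rewrite -sqr_nrm exprn_gt0.
  have [dF FdF] : exists l, is_derive (ip a a) 1 F l.
    have h1 := is_derive1_sqrt ipa0.
    have h2 : is_derive (nrm a) 1 rho _ := is_derive_rho ga0.
    have := @is_derive1_comp _ rho Num.sqrt (ip a a) _ _ h2 h1.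
    by move=> h3; eexists; exact: h3.
  have yr : (ip (an n) (an n) - ip a a) / h n @[n --> \oo] --> ip p (a \+ a).
    have -> : (fun n => (ip (an n) (an n) - ip a a) / h n) =
        (fun n => ip (fun i => (an n i - a i) / h n) (fun i => an n i + a i)).
      apply/funext => n; rewrite /ip -sumrB mulr_suml; apply: eq_bigr => i _.
      by field; exact: h0.
    by apply: cvg_ip => // i; apply: cvgD => //; exact: cvg_cst.
  have Fr := cvg_diff_quotient_comp FdF h0 hcvg yr.
  exists (fun i => rho (nrm a) * p i + dF * ip p (a \+ a) * a i) => i.
  have -> : (fun n => (radial rho (an n) i - radial rho a i) / h n) =
    (fun n => F (ip (an n) (an n)) * ((an n i - a i) / h n)
              + (F (ip (an n) (an n)) - F (ip a a)) / h n * a i).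
    by apply/funext => n; rewrite /radial /F /nrm; field; exact: h0.
  apply: cvgD; last by apply: cvgM => //; exact: cvg_cst.
  apply: cvgM => //.
  have -> : rho (nrm a) = F (ip a a) by [].
  have Fc : {for ip a a, continuous F}.
    by apply/differentiable_continuous/derivable1_diffP; have [] := FdF.
  apply: (cvg_comp (fun n => ip (an n) (an n)) F _ Fc).
  exact: cvg_ip.
(* At [a = 0] the quotient is [rho (nrm (an n)) * (an n i / h n)]: either [p = 0] and its
   norm tends to [ip p w = 0], or [p != 0] and [phi (nrm (an n))] converges. *)
have ai0 := nrm_eq0 a0.
have vE f n i : (radial f (an n) i - radial f a i) / h n = f (nrm (an n)) * (an n i / h n).
  by rewrite /radial ai0 mulr0 subr0 mulrA.
have {}ap i : an n i / h n @[n --> \oo] --> p i.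
  by have := ap i; rewrite ai0 (_ : (fun n => _) = (fun n => an n i / h n))//;
     apply/funext => n; rewrite subr0.
have sq : ip (fun i => rho (nrm (an n)) * (an n i / h n))
             (fun i => rho (nrm (an n)) * (an n i / h n)) @[n --> \oo] --> ip p w.
  have -> : (fun n => ip (fun i => rho (nrm (an n)) * (an n i / h n))
             (fun i => rho (nrm (an n)) * (an n i / h n))) =
    (fun n => ip (fun i => an n i / h n)
                (fun i => (radial phi (an n) i - radial phi a i) / h n)).
    apply/funext => n.
    rewrite (_ : (fun i => (radial phi (an n) i - radial phi a i) / h n) =
      fun i => phi (nrm (an n)) * (an n i / h n)); last by apply/funext => i; exact: vE.
    rewrite !ipZl !ipZr mulrA.
    have [/nrm_eq0 n0|n0] := eqVneq (nrm (an n)) 0.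
      by rewrite /ip big1 ?mulr0// => i _; rewrite n0 mul0r mul0r.
    rewrite -expr2 sqr_sqrtr// ltW// phi0// lt_def n0 nrm_ge0//.
  exact: cvg_ip.
have [p0|p0] := eqVneq (nrm p) 0.
  have pw : ip p w = 0.
    by rewrite /ip big1// => i _; rewrite (nrm_eq0 p0) mul0r.
  exists (fun=> 0) => i.
  under eq_fun do rewrite vE.
  apply/norm_cvg0P.
  have sq0 : Num.sqrt (ip (fun i => rho (nrm (an n)) * (an n i / h n))
             (fun i => rho (nrm (an n)) * (an n i / h n))) @[n --> \oo] --> (0 : R).
    rewrite -(sqrtr0 R) -pw; apply: (cvg_comp _ _ sq); exact: sqrt_continuous.
  apply: (squeeze_cvgr _ (cvg_cst 0) sq0); near=> n.
  rewrite normr_ge0/= -sqrtr_sqr ler_sqrt; last exact: ip_ge0.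
  rewrite /ip (bigD1 i)//= -expr2 lerDl; apply: sumr_ge0 => j _.
  by rewrite -expr2 sqr_ge0.
have pp0 : 0 < ip p p by rewrite -sqr_nrm exprn_gt0// lt_def p0 nrm_ge0.
have phicvg : rho (nrm (an n)) @[n --> \oo] --> Num.sqrt (ip p w / ip p p).
  have q2 := cvg_ip ap ap.
  have q := cvgM sq (cvgV (lt0r_neq0 pp0) q2).
  have {}q := cvg_comp _ _ (q _ _) (@sqrt_continuous R _).
  apply: cvg_trans (q _ _); apply: near_eq_cvg; near=> n.
  have pn0 : 0 < ip (fun i => an n i / h n) (fun i => an n i / h n).
    near: n; exact: (cvgr_gt _ q2).
  rewrite -[LHS]/(Num.sqrt (
    ip (fun i => rho (nrm (an n)) * (an n i / h n))
       (fun i => rho (nrm (an n)) * (an n i / h n)) /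
    ip (fun i => an n i / h n) (fun i => an n i / h n))).
  rewrite !ipZl !ipZr mulrA mulfK ?gt_eqF// -expr2 sqrtr_sqr ger0_norm//.
  exact: sqrtr_ge0.
exists (fun i => Num.sqrt (ip p w / ip p p) * p i) => i.
by under eq_fun do rewrite vE; exact: cvgM.
Unshelve. all: by end_near. Qed.

(** The lower bound is [radial_monotone], divided by h^2. For the upper bound the remainder in
    [radial_identity] must be nonnegative: it is 0 when a = 0, and otherwise <a_n, a> tends to |a|^2
    > 0 and is eventually positive. *)
Lemma radial_diff_quotient_limits a (an : nat -> I -> R) (h : nat -> R) p w z :
  (forall n, h n != 0) -> h n @[n --> \oo] --> 0 ->
  (forall i, (an n i - a i) / h n @[n --> \oo] --> p i) ->
  (forall i, (radial phi (an n) i - radial phi a i) / h n @[n --> \oo] --> w i) ->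
  (forall i, (radial rho (an n) i - radial rho a i) / h n @[n --> \oo] --> z i) ->
  delta * ip z z <= ip p w <= ip z z.
Proof.
move=> h0 hcvg ap bw cz.
have pw := cvg_ip ap bw; have zz := cvg_ip cz cz.
have E (b c : I -> R) n : ip (fun i => b i / h n) (fun i => c i / h n) =
    h n ^- 2 * ip b c.
  rewrite /ip mulr_sumr; apply: eq_bigr => i _; field; exact: h0.
have zzE n : ip (fun i => (radial rho (an n) i - radial rho a i) / h n)
    (fun i => (radial rho (an n) i - radial rho a i) / h n) =
    h n ^- 2 * ip (radial rho (an n) \- radial rho a) (radial rho (an n) \- radial rho a).
  exact: E.
have pwE n : ip (fun i => (an n i - a i) / h n)
    (fun i => (radial phi (an n) i - radial phi a i) / h n) =
    h n ^- 2 * ip (an n \- a) (radial phi (an n) \- radial phi a).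
  exact: E.
have h20 n : 0 <= h n ^- 2 by rewrite invr_ge0 sqr_ge0.
apply/andP; split.
  apply: (ler_cvg_to (cvgM (cvg_cst delta) zz) pw); near=> n.
  rewrite /= zzE pwE mulrCA; apply: ler_wpM2l => //; exact: radial_monotone.
have [a0|a0] := eqVneq (nrm a) 0.
  apply: (ler_cvg_to pw zz); near=> n.
  rewrite zzE pwE; apply: ler_wpM2l => //.
  rewrite -subr_ge0 radial_identity /ip [X in _ * X]big1 ?mulr0// => i _.
  by rewrite (nrm_eq0 a0) mulr0.
have ipa0 : 0 < ip a a by rewrite -sqr_nrm exprn_gt0// lt_def a0 nrm_ge0.
have ana i : an n i @[n --> \oo] --> a i.
  have -> : (fun n => an n i) = (fun n => (an n i - a i) / h n * h n + a i).
    by apply/funext => k; rewrite mulfVK// subrK.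
  rewrite -[X in _ --> X]add0r; apply: cvgD; last exact: cvg_cst.
  by rewrite -(mulr0 (p i)); exact: cvgM.
have ipn : ip (an n) a @[n --> \oo] --> ip a a.
  by apply: cvg_ip => // i; exact: cvg_cst.
apply: (ler_cvg_to pw zz); near=> n.
rewrite zzE pwE; apply: ler_wpM2l => //.
rewrite -subr_ge0 radial_identity mulr_ge0 ?sqr_ge0//.
by apply: ltW; near: n; exact: (cvgr_gt _ ipn _ ipa0).
Unshelve. all: by end_near. Qed.

End vectors.

End radial_maps.

(** * Lebesgue measure on row vectors *)

Section boxes.
Context {R : realType} {N : nat}.
Local Notation T := 'rV[R]_N.
Local Notation mu := (lebesgue_rV R N).
Implicit Types (a b c x y v : T).

Definition obox a b : set T := [set v | forall i, v ord0 i \in `]a ord0 i, b ord0 i[].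
Definition cbox a b : set T := [set v | forall i, v ord0 i \in `[a ord0 i, b ord0 i]].

Lemma measurable_obox a b : measurable (obox a b).
Proof.
by apply: (measurable_rV_box (B := fun i => `]a ord0 i, b ord0 i[%classic)) => i.
Qed.

Lemma measurable_cbox a b : measurable (cbox a b).
Proof.
by apply: (measurable_rV_box (B := fun i => `[a ord0 i, b ord0 i]%classic)) => i.
Qed.

Lemma compact_cbox a b : compact (cbox a b).
Proof.
apply: (@rV_compact _ _ (fun i => `[a ord0 i, b ord0 i]%classic)) => i.
exact: segment_compact.
Qed.

Lemma obox_cbox a b : obox a b `<=` cbox a b.
Proof. by move=> v abv i; apply: subset_itv_oo_cc; exact: abv. Qed.

Lemma cbox_lty a b : (mu (cbox a b) < +oo)%E.
Proof.
rewrite (lebesgue_rV_box (B := fun i => `[a ord0 i, b ord0 i]%classic))//.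
have h i : exists2 r : R, 0 <= r &
    lebesgue_measure (`[a ord0 i, b ord0 i]%classic : set (measurableTypeR R)) = r%:E.
  rewrite lebesgue_measure_itv/=; case: ifPn => [ab|_]; last by exists 0.
  by exists (b ord0 i - a ord0 i); rewrite ?EFinB// subr_ge0 ltW.
elim/big_rec : _ => [|i z _ zoo]; first exact: ltry.
have [r r0 ->] := h i.
by rewrite lte_mul_pinfty.
Qed.

Lemma obox_lty a b : (mu (obox a b) < +oo)%E.
Proof.
apply: le_lt_trans (cbox_lty a b); apply: le_measure; rewrite ?inE.
- exact: measurable_obox.
- exact: measurable_cbox.
- exact: obox_cbox.
Qed.

Lemma obox_setI a b c d : obox a b `&` obox c d =
  obox (\row_i Num.max (a ord0 i) (c ord0 i)) (\row_i Num.min (b ord0 i) (d ord0 i)).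
Proof.
apply/seteqP; split => [v [abv cdv] i|v abv].
  have := abv i; have := cdv i; rewrite !mxE !in_itv/= gt_max lt_min.
  by move=> /andP[-> ->] /andP[-> ->].
split=> i; have := abv i; rewrite !mxE !in_itv/= gt_max lt_min.
  by case/andP => /andP[-> _] /andP[-> _].
by case/andP => /andP[_ ->] /andP[_ ->].
Qed.

Lemma setI_obox : setI_closed [set obox p.1 p.2 | p in [set: T * T]].
Proof.
move=> _ _ [[a b] _ <-] [[c d] _ <-]/=; rewrite obox_setI.
by exists (\row_i Num.max (a ord0 i) (c ord0 i), \row_i Num.min (b ord0 i) (d ord0 i)).
Qed.

Lemma ler_coord_norm x i : `|x ord0 i| <= `|x|.
Proof.
rewrite [leRHS]/Num.norm /= mx_normrE.
by apply/bigmax_geP; right => /=; exists (ord0, i).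
Qed.

Lemma bigcup_obox : \bigcup_k obox (const_mx (- k%:R)) (const_mx k%:R) = [set: T].
Proof.
rewrite -subTset => x _.
exists (Num.truncn `|x|).+1 => // i; rewrite !mxE in_itv/= -ltr_norml.
exact: le_lt_trans (ler_coord_norm x i) (truncnS_gt _).
Qed.

(** Open boxes are stable under intersection, so this description of the sigma-algebra opens the way
    to uniqueness of measures and to Dynkin's pi-lambda argument. *)
Lemma measurable_rVE :
  measurable = <<s [set obox p.1 p.2 | p in [set: T * T]] >>.
Proof.
apply/seteqP; split; last first.
  apply: smallest_sub; first exact: sigma_algebra_measurable.
  by move=> _ [p _ <-]; exact: measurable_obox.
set S := <<s _ >>.
pose ST : measurableType _ := g_sigma_algebraType [set obox p.1 p.2 | p in [set: T * T]].
have gt_meas i (r : R) : @measurable _ ST [set v : T | r < v ord0 i].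
  have -> : [set v : T | r < v ord0 i] =
      \bigcup_k obox (\row_j if j == i then r else - k%:R) (const_mx k%:R).
    apply/seteqP; split => [v rv|v [k _ /(_ i)]]; last first.
      by rewrite !mxE eqxx in_itv/= => /andP[].
    have : [set: T] v by [].
    rewrite -bigcup_obox => -[k _ kv]; exists k => // j.
    have := kv j; rewrite !mxE !in_itv/= => /andP[kj ->]; rewrite andbT.
    by case: eqP => // ->.
  apply: bigcupT_measurable => k; apply: sub_sigma_algebra.
  by exists (\row_j if j == i then r else - k%:R, const_mx k%:R).
have mcoord i : @measurable_fun _ _ ST (measurableTypeR R) setT (fun v : T => v ord0 i).
  apply: (measurability _ (RGenOInfty.measurableE R)) => _ [_ [r ->] <-].
  rewrite setTI (_ : _ @^-1` _ = [set v : T | r < v ord0 i]) ?gt_meas//.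
  by apply/seteqP; split=> v /=; rewrite in_itv/= andbT.
(* Measurability of all coordinates says that the identity is measurable from the space with the
   sigma-algebra generated by boxes to the space with the product one; this is the inclusion
   sought. *)
have /measurable_rVP : forall i, @measurable_fun _ _ ST (measurableTypeR R) setT
    (fun v : ST => (id v : T) ord0 i).
  exact: mcoord.
by move=> mid A mA; have := mid measurableT A mA; rewrite setTI.
Qed.

(** An enumeration of the boxes with rational corners. Numbers that encode no pair give (0, 0),
    which is harmless because only boxes whose closure lies in the open set are selected later. *)
Definition rat_corners (n : nat) : T * T :=
  let p := odflt (0, 0) (unpickle n : option ('rV[rat]_N * 'rV[rat]_N)) in
  (map_mx ratr p.1, map_mx ratr p.2).

Arguments rat_corners : simpl never.

Lemma open_bigcup_obox (O : set T) : open O ->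
  O = \bigcup_(n in [set n | cbox (rat_corners n).1 (rat_corners n).2 `<=` O])
      obox (rat_corners n).1 (rat_corners n).2.
Proof.
move=> oO; apply/seteqP; split => [x Ox|x [n nO] /obox_cbox]; last exact: nO.
have /nbhs_ballP[e e0 eO] : nbhs x O by exact: open_nbhs_nbhs.
have hq i : exists q : rat, ratr q \in `]x ord0 i - e, x ord0 i[.
  by apply: rat_in_itvoo; rewrite ltrBlDr ltrDl.
have hr i : exists q : rat, ratr q \in `]x ord0 i, x ord0 i + e[.
  by apply: rat_in_itvoo; rewrite ltrDl.
pose q i := sval (cid (hq i)); pose r i := sval (cid (hr i)).
have [n nE] : exists n, rat_corners n =
    (map_mx ratr (\row_i q i), map_mx ratr (\row_i r i)).
  by exists (pickle (\row_i q i, \row_i r i)); rewrite /rat_corners pickleK.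
exists n; rewrite /mkset nE.
  move=> v abv; apply: eO; split=> // i j; rewrite (ord1 i).
  have := abv j; rewrite !mxE in_itv/= => /andP[qv vr].
  have := svalP (cid (hq j)); rewrite in_itv/= -/(q j) => /andP[q1 q2].
  have := svalP (cid (hr j)); rewrite in_itv/= -/(r j) => /andP[r1 r2].
  by rewrite /ball/= ltr_norml; apply/andP; split; lra.
move=> i; rewrite !mxE in_itv/=.
have := svalP (cid (hq i)); rewrite in_itv/= -/(q i) => /andP[q1 q2].
have := svalP (cid (hr i)); rewrite in_itv/= -/(r i) => /andP[r1 r2].
by rewrite q2 r1.
Qed.

Lemma open_measurable_rV (O : set T) : open O -> measurable O.
Proof.
move=> /open_bigcup_obox ->; apply: bigcup_measurable => n _.
exact: measurable_obox.
Qed.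

Lemma continuous_measurable_rV (f : T -> R) : continuous f -> measurable_fun setT f.
Proof.
move=> /continuousP cf.
apply: (measurability _ (RGenOInfty.measurableE R)) => _ [_ [r ->] <-].
by rewrite setTI; apply: open_measurable_rV; apply: cf; exact: interval_open.
Qed.

Lemma compact_sub_cbox (K : set T) : compact K ->
  exists2 M : R, 0 < M & K `<=` cbox (const_mx (- M)) (const_mx M).
Proof.
move=> /compact_bounded [M [_ KM]]; exists (`|M| + 1).
  by rewrite ltr_pwDr.
move=> x Kx i; rewrite !mxE in_itv/= -ler_norml.
apply: le_trans (ler_coord_norm x i) _.
by apply: KM Kx; rewrite (le_lt_trans (ler_norm _))// ltrDl.
Qed.

Definition shift_rV c x : T := x + c.

Lemma measurable_shift_rV c : measurable_fun setT (shift_rV c).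
Proof.
apply/measurable_rVP => i; under eq_fun do rewrite mxE.
apply: measurable_funD; first exact: measurable_rV_coord.
exact: measurable_cst.
Qed.

HB.instance Definition _ c :=
  isMeasurableFun.Build _ _ _ _ (shift_rV c) (measurable_shift_rV c).

(** A translated box has the same side lengths; two measures that agree on boxes, and are finite on
    the cubes exhausting the space, coincide. *)
Lemma pushforward_shift c (A : set T) : measurable A ->
  pushforward mu (shift_rV c) A = mu A.
Proof.
apply: (@measure_unique _ _ _ _ _ measurable_rVE setI_obox _ bigcup_obox) => [k|_ [[a b] _ <-]/=|k].
- by exists (const_mx (- k%:R), const_mx k%:R).
- rewrite /pushforward.
  have -> : shift_rV c @^-1` obox a b = obox (a - c) (b - c).
    apply/seteqP; split => v vab i; have := vab i;
      by rewrite !mxE !in_itv/= ltrBlDr ltrBrDr.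
  rewrite (lebesgue_rV_box (B := fun i => `](a - c) ord0 i, (b - c) ord0 i[%classic))//.
  rewrite (lebesgue_rV_box (B := fun i => `]a ord0 i, b ord0 i[%classic))//.
  apply: eq_bigr => i _; rewrite !lebesgue_measure_itv/= !mxE !lte_fin.
  rewrite ltrBlDr subrK; case: ifPn => // _.
  by rewrite -!EFinD; congr EFin; ring.
- rewrite /= /pushforward.
  have -> : shift_rV c @^-1` obox (const_mx (- k%:R)) (const_mx k%:R) =
      obox (const_mx (- k%:R) - c) (const_mx k%:R - c).
    apply/seteqP; split => v vab i; have := vab i;
      by rewrite !mxE !in_itv/= ltrBlDr ltrBrDr.
  exact: obox_lty.
Qed.

Lemma ge0_integral_shift c (f : T -> \bar R) : measurable_fun setT f ->
  (forall x, 0 <= f x)%E ->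
  (\int[mu]_x f (x + c)%R = \int[mu]_x f x)%E.
Proof.
move=> mf f0.
transitivity (\int[pushforward mu (shift_rV c)]_x f x)%E.
  by rewrite ge0_integral_pushforward// preimage_setT.
by apply: eq_measure_integral => A mA _; exact: pushforward_shift.
Qed.

Lemma integrable_integral_shift c (f : T -> \bar R) : mu.-integrable setT f ->
  (\int[mu]_x f (x + c)%R = \int[mu]_x f x)%E.
Proof.
move=> /integrableP[mf foo].
rewrite [LHS]integralE [RHS]integralE; congr (_ - _)%E.
  rewrite -(@ge0_integral_shift c f^\+%E)//; last exact: measurable_funepos.
  by apply: eq_integral => x _; rewrite !funeposE.
rewrite -(@ge0_integral_shift c f^\-%E)//; last exact: measurable_funeneg.
by apply: eq_integral => x _; rewrite !funenegE.
Qed.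

End boxes.

(** * Difference quotients in L^2 *)

Lemma nneg_cvg0P (R : realType) (u : nat -> \bar R) : (forall n, 0 <= u n)%E ->
  u n @[n --> \oo] --> 0%E <->
  forall e : R, 0 < e -> \forall n \near \oo, (u n <= e%:E)%E.
Proof.
move=> u0; split=> [/fine_cvgP[ufin /cvgr0_norm_le u_cvg] e e0|h].
  have ue := u_cvg _ e0; near=> n.
  have un : u n \is a fin_num by near: n.
  rewrite -(fineK un) lee_fin (le_trans (ler_norm _))//.
  by near: n.
have fin : \forall n \near \oo, u n \is a fin_num.
  near=> n; rewrite ge0_fin_numE//; apply: (@le_lt_trans _ _ 1%:E); last exact: ltry.
  by near: n; exact: h.
apply/fine_cvgP; split => //; apply/cvgr0Pnorm_le => e e0; near=> n.
have un : u n \is a fin_num by near: n.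
rewrite ger0_norm/= ?fine_ge0// -lee_fin fineK//.
by near: n; exact: h.
Unshelve. all: by end_near. Qed.

Section difference_quotients.
Context {R : realType} {N : nat} (k : 'I_N).
Local Notation T := 'rV[R]_N.
Local Notation mu := (lebesgue_rV R N).
Local Notation ek := (delta_mx ord0 k : T).
Implicit Types (f g psi : T -> R) (x y : T) (h : R).

(** Regularity is asked only in the one direction being differentiated. The class is stable under
    differences and contains the real and imaginary parts of test functions. *)
Definition C1c psi : Prop := [/\ continuous psi, forall x, derivable psi x ek,
  continuous (pderiv k psi) &
  exists2 M : R, 0 < M & forall x, ~ cbox (const_mx (- M)) (const_mx M) x -> psi x = 0].

Definition dquot h f x : R := (f (x + h *: ek) - f x) / h.

Arguments dquot h f%_R.

Lemma cbox_widen (M M' : R) x : M <= M' ->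
  cbox (const_mx (- M)) (const_mx M) x -> cbox (const_mx (- M')) (const_mx M') x.
Proof.
move=> MM' xM i; have := xM i; rewrite !mxE !in_itv/= => /andP[h1 h2].
by apply/andP; split; lra.
Qed.

Lemma cvg_dquot psi (hn : nat -> R) x : derivable psi x ek ->
  (forall n, hn n != 0) -> hn n @[n --> \oo] --> 0 ->
  dquot (hn n) psi x @[n --> \oo] --> pderiv k psi x.
Proof.
move=> dpsi h0 hcvg.
have hd : hn n @[n --> \oo] --> (0 : R)^'.
  move=> A; rewrite /dnbhs /within /= => A0.
  have : \forall n \near \oo, hn n != 0 -> A (hn n) by exact: hcvg A0.
  by apply: filterS => n; apply; exact: h0.
have := cvg_comp _ _ hd dpsi.
apply: cvg_trans; apply: near_eq_cvg; near=> n.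
by rewrite /dquot /= /GRing.scale/= mulrC [x + _]addrC.
Unshelve. all: by end_near. Qed.

Lemma C1cB f g : C1c f -> C1c g ->
  C1c (f \- g) /\ pderiv k (f \- g) = pderiv k f \- pderiv k g.
Proof.
move=> [cf df cdf [M M0 fM]] [cg dg cdg [M' M'0 gM']].
have dfg : pderiv k (f \- g) = pderiv k f \- pderiv k g.
  by apply/funext => x; rewrite /pderiv deriveB.
split; last exact: dfg.
split.
- by move=> x; exact: (continuousB (cf x) (cg x)).
- by move=> x; exact: derivableB.
- by rewrite dfg => x; exact: (continuousB (cdf x) (cdg x)).
- exists (Num.max M M'); first by rewrite lt_max M0.
  move=> x xM /=; rewrite fM ?gM' ?subrr// => xM'; apply: xM; apply: cbox_widen xM'.
    by rewrite le_max lexx orbT.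
  by rewrite le_max lexx.
Qed.

Lemma pderiv_outside psi (K : set T) x : closed K ->
  (forall y, ~ K y -> psi y = 0) -> ~ K x -> pderiv k psi x = 0.
Proof.
move=> cK psiK xK.
rewrite /pderiv -(derive_cst (0 : R) x ek); apply: near_eq_derive.
have : nbhs x (~` K) by apply: open_nbhs_nbhs; split => //; exact: closed_openC.
by apply: filterS => y yK; rewrite psiK.
Qed.

Lemma closed_cbox (a b : T) : closed (cbox a b).
Proof. by apply: compact_closed; [exact: norm_hausdorff|exact: compact_cbox]. Qed.

Lemma C1c_bounded psi : C1c psi ->
  exists2 C : R, 0 <= C & forall x, `|pderiv k psi x| <= C.
Proof.
move=> [_ _ cd [M M0 psiM]].
have := @continuous_compact _ _ _ _ (continuous_subspaceT cd)
  (@compact_cbox R N (const_mx (- M)) (const_mx M)).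
move=> /compact_bounded[C [_ hC]]; exists (`|C| + 1); first by rewrite addr_ge0.
move=> x; have [xM|xM] := pselect (cbox (const_mx (- M)) (const_mx M) x).
  apply: hC; last by exists x.
  by rewrite (le_lt_trans (ler_norm _))// ltrDl.
by rewrite (pderiv_outside (@closed_cbox _ _) psiM xM) normr0 addr_ge0.
Qed.

Lemma C1c_lipschitz psi (C : R) : C1c psi -> (forall x, `|pderiv k psi x| <= C) ->
  forall h x, h != 0 -> `|dquot h psi x| <= C.
Proof.
move=> [cpsi dpsi _ _] hC h x h0.
pose g (t : R) : R := psi (x + t *: ek).
have dg (t : R) : is_derive t 1 g (pderiv k psi (x + t *: ek)).
  have E : (fun s : R => s^-1 *: (g (s *: 1 + t) - g t)) =
      (fun s => s^-1 *: (psi (s *: ek + (x + t *: ek)) - psi (x + t *: ek))).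
    apply/funext => s; rewrite /g; congr (_ *: (psi _ - _)).
    by rewrite [s *: 1]mulr1 scalerDl addrCA.
  split; first by rewrite /derivable E; exact: dpsi.
  by rewrite /derive E.
have cg : continuous g.
  by move=> t; apply/differentiable_continuous/derivable1_diffP; have [] := dg t.
rewrite /dquot normrM normfV ler_pdivrMr ?normr_gt0//.
have -> : psi (x + h *: ek) - psi x = g h - g 0 by rewrite /g scale0r addr0.
have [h1|h1|h1] := ltgtP h 0; last by rewrite h1 eqxx in h0.
  have [c _ E] := @MVT R g _ h 0 h1 (fun t _ => dg t) (continuous_subspaceT cg).
  by rewrite distrC E normrM sub0r normrN ler_wpM2r.
have [c _ E] := @MVT R g _ 0 h h1 (fun t _ => dg t) (continuous_subspaceT cg).
by rewrite E normrM subr0 ler_wpM2r.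
Qed.

Lemma C1c_dquot_bound psi : C1c psi -> exists C M : R,
  [/\ 0 < M, 0 <= C,
   forall h x, h != 0 -> `|h| <= 1 ->
     `|dquot h psi x| <= C * \1_(cbox (const_mx (- M)) (const_mx M)) x &
   forall x, `|pderiv k psi x| <= C * \1_(cbox (const_mx (- M)) (const_mx M)) x].
Proof.
move=> cpsi; have [C C0 hC] := C1c_bounded cpsi.
have [_ _ _ [M M0 psiM]] := cpsi.
(* A step of length at most 1 moves the support by at most 1, so one cube serves for all
   quotients. *)
exists C, (M + 1); split => //.
- by rewrite addr_gt0.
- move=> h x h0 h1; rewrite indicE.
  have [xM|xM] := pselect (cbox (const_mx (- (M + 1))) (const_mx (M + 1)) x).
    by rewrite mem_set// mulr1; exact: C1c_lipschitz.
  rewrite memNset// mulr0 /dquot !psiM ?subrr ?mul0r ?normr0//.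
    move=> xM'; apply: xM; apply: cbox_widen xM'; by rewrite lerDl.
  move=> xM'; apply: xM => i; have := xM' i.
  rewrite !mxE !in_itv/= ?eqxx/= => /andP[].
  have : `|h * (i == k)%:R| <= 1.
    by case: eqP => _; rewrite ?mulr1// mulr0 normr0.
  by rewrite ler_norml => /andP[? ?] ? ?; apply/andP; split; lra.
- move=> x; rewrite indicE.
  have [xM|xM] := pselect (cbox (const_mx (- (M + 1))) (const_mx (M + 1)) x).
    by rewrite mem_set// mulr1.
  rewrite memNset// mulr0 (pderiv_outside (@closed_cbox _ _) psiM) ?normr0// => xM'.
  by apply: xM; apply: cbox_widen xM'; rewrite lerDl.
Qed.

Definition sqn f : \bar R := (\int[mu]_x ((f x) ^+ 2)%:E)%E.

Arguments sqn f%_R.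

Lemma sqn_ge0 f : (0 <= sqn f)%E.
Proof. by apply: integral_ge0 => x _; rewrite lee_fin sqr_ge0. Qed.

Lemma sqn_cvg0P (g : nat -> T -> R) : sqn (g n) @[n --> \oo] --> 0%E <->
  forall e : R, 0 < e -> \forall n \near \oo, (sqn (g n) <= e%:E)%E.
Proof. by apply: nneg_cvg0P => n; exact: sqn_ge0. Qed.

Lemma measurable_sqn f : measurable_fun setT f ->
  measurable_fun setT (fun x => ((f x) ^+ 2)%:E).
Proof. by move=> mf; apply/measurable_EFinP; exact: measurable_funX. Qed.

Lemma sqnD f g : measurable_fun setT f -> measurable_fun setT g ->
  (sqn (f \+ g) <= 2%:E * sqn f + 2%:E * sqn g)%E.
Proof.
move=> mf mg; rewrite /sqn -!ge0_integralZl//; first last.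
- by move=> x _; rewrite lee_fin sqr_ge0.
- exact: measurable_sqn.
- by move=> x _; rewrite lee_fin sqr_ge0.
- exact: measurable_sqn.
rewrite -ge0_integralD//; first last.
- by apply: measurable_funeM; exact: measurable_sqn.
- by move=> x _; rewrite mule_ge0// lee_fin sqr_ge0.
- by apply: measurable_funeM; exact: measurable_sqn.
- by move=> x _; rewrite mule_ge0// lee_fin sqr_ge0.
apply: ge0_le_integral => //.
- by move=> x _; rewrite lee_fin sqr_ge0.
- by apply: measurable_sqn; exact: measurable_funD.
- by apply: emeasurable_funD; apply: measurable_funeM; exact: measurable_sqn.
move=> x _; rewrite -!EFinM -EFinD lee_fin/=.
by have := sqr_ge0 (f x - g x); lra.
Qed.

Lemma sqnZ (c : R) f : measurable_fun setT f ->
  sqn (fun x => c * f x) = ((c ^+ 2)%:E * sqn f)%E.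
Proof.
move=> mf; rewrite /sqn -ge0_integralZl//; first last.
- by rewrite lee_fin sqr_ge0.
- by move=> x _; rewrite lee_fin sqr_ge0.
- exact: measurable_sqn.
by apply: eq_integral => x _; rewrite exprMn EFinM.
Qed.

Lemma measurable_shift (c : T) f : measurable_fun setT f ->
  measurable_fun setT (fun x => f (x + c)).
Proof. by move=> mf; apply: (measurableT_comp mf); exact: (measurable_shift_rV c). Qed.

Lemma sqn_shift (c : T) f : measurable_fun setT f -> sqn (fun x => f (x + c)) = sqn f.
Proof.
move=> mf; rewrite /sqn (@ge0_integral_shift _ _ c (fun x => (f x ^+ 2)%:E))//.
  exact: measurable_sqn.
by move=> x; rewrite lee_fin sqr_ge0.
Qed.

Lemma measurable_dquot h f : measurable_fun setT f -> measurable_fun setT (dquot h f).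
Proof.
move=> mf; apply: measurable_funM; last exact: measurable_cst.
by apply: measurable_funB => //; exact: measurable_shift.
Qed.

Lemma C1c_measurable f : C1c f -> measurable_fun setT f.
Proof. by case=> cf _ _ _; exact: continuous_measurable_rV. Qed.

Lemma C1c_measurable_pderiv f : C1c f -> measurable_fun setT (pderiv k f).
Proof. by case=> _ _ cf _; exact: continuous_measurable_rV. Qed.

Definition dyadic (n : nat) : R := 2^-1 ^+ n.

Lemma dyadic_gt0 n : 0 < dyadic n. Proof. by rewrite exprn_gt0. Qed.

Lemma dyadic_neq0 n : dyadic n != 0. Proof. by rewrite gt_eqF// dyadic_gt0. Qed.

Lemma dyadic_le1 n : dyadic n <= 1.
Proof. by apply: exprn_ile1; rewrite ?invr_ge0// invf_le1 ?ler1n. Qed.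

Lemma cvg_dyadic : dyadic n @[n --> \oo] --> (0 : R).
Proof. by apply: cvg_expr; rewrite ger0_norm// invf_lt1// ltr1n. Qed.

(* A dyadic quotient is the mean of two translates of the quotient with half the
   step. Iterating bounds the quotients of a test function by its derivative,
   without integrating along lines. *)
Lemma sqn_dquotS n f : measurable_fun setT f ->
  (sqn (dquot (dyadic n) f) <= sqn (dquot (dyadic n.+1) f))%E.
Proof.
move=> mf; set h := dyadic n.+1.
have hE : dyadic n = h + h by rewrite /h /dyadic exprS; field.
have h0 : h != 0 by exact: dyadic_neq0.
have -> : dquot (dyadic n) f =
    (fun x => 2^-1 * dquot h f x) \+ (fun x => 2^-1 * dquot h f (x + h *: ek)).
  apply/funext => x; rewrite /dquot hE scalerDl addrA /=.
  by field; rewrite h0 -mulr2n mulrn_eq0 h0.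
have md := measurable_dquot h mf.
have md' := measurable_shift (h *: ek) md.
have mc (g : T -> R) : measurable_fun setT g -> measurable_fun setT (fun x => 2^-1 * g x).
  by move=> mg; apply: measurable_funM => //; exact: measurable_cst.
apply: (le_trans (sqnD (mc _ md) (mc _ md'))).
rewrite !sqnZ// (@sqn_shift (h *: ek) (dquot h f))// !muleA -!EFinM -ge0_muleDl ?lee_fin//.
(* The factor 2 of [sqnD] is exactly compensated: 2 / 4 + 2 / 4 = 1. No constant accumulates when
   the step is halved repeatedly. *)
by rewrite -EFinD (_ : _ + _ = 1) ?mul1e//; field.
Qed.

Lemma sqn_dquot_le n p f : (n <= p)%N -> measurable_fun setT f ->
  (sqn (dquot (dyadic n) f) <= sqn (dquot (dyadic p) f))%E.
Proof.
move=> np mf; elim: p np => [|p IHp]; first by rewrite leqn0 => /eqP ->.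
rewrite leq_eqVlt => /predU1P[->//|/IHp h]; exact: le_trans (sqn_dquotS _ mf).
Qed.

Lemma sqn_dquot_C1c psi : C1c psi ->
  sqn (dquot (dyadic n) psi \- pderiv k psi) @[n --> \oo] --> 0%E.
Proof.
move=> cpsi; have [C [M [M0 C0 hC hD]]] := C1c_dquot_bound cpsi.
pose B : set T := cbox (const_mx (- M)) (const_mx M).
have mB : measurable B by exact: measurable_cbox.
have mq n : measurable_fun setT (dquot (dyadic n) psi \- pderiv k psi).
  apply: measurable_funB; last exact: C1c_measurable_pderiv.
  by apply: measurable_dquot; exact: C1c_measurable.
have [] := @dominated_convergence _ _ _ mu setT measurableT
  (fun n x => (((dquot (dyadic n) psi \- pderiv k psi) x) ^+ 2)%:E) (cst 0%E)
  (fun x => ((2 * C) ^+ 2 * \1_B x)%:E).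
- by move=> n; apply: measurable_sqn.
- exact: measurable_cst.
- apply: nearW => x _; apply: cvg_EFin; first exact: nearW.
  rewrite -[X in _ --> X](expr0n _ 2).
  have := @cvg_dquot psi dyadic x _ dyadic_neq0 cvg_dyadic.
  case: cpsi => _ dpsi _ _ => /(_ (dpsi x)) h.
  have h2 : (dquot (dyadic n) psi \- pderiv k psi) x @[n --> \oo] --> (0 : R).
    rewrite -(subrr (pderiv k psi x)); apply: cvgB => //; exact: cvg_cst.
  exact: (cvg_comp _ (fun y : R => y ^+ 2) h2 (@exprn_continuous _ 2 _)).
- apply/integrableP; split.
    by apply/measurable_EFinP; apply: measurable_funM => //; exact: measurable_indic.
  under eq_integral => x _.
    rewrite gee0_abs; last by rewrite lee_fin mulr_ge0// ?sqr_ge0// indicE.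
    rewrite EFinM; over.
  rewrite ge0_integralZl//; first last.
  + by rewrite lee_fin sqr_ge0.
  + by apply/measurable_EFinP; exact: measurable_indic.
  rewrite integral_indic// setIT lte_mul_pinfty// ?lee_fin ?sqr_ge0//.
  exact: cbox_lty.
- apply: nearW => x n _.
  rewrite gee0_abs ?lee_fin ?sqr_ge0//.
  have := hC (dyadic n) x (dyadic_neq0 n); rewrite (ger0_norm (ltW (dyadic_gt0 n))).
  move=> /(_ (dyadic_le1 n)); have := hD x; rewrite -/B indicE.
  case: (x \in B); rewrite ?mulr1 ?mulr0 => h1 h2.
    rewrite -real_normK ?num_real// lerXn2r ?nnegrE ?mulr_ge0//.
    by rewrite (le_trans (ler_normB _ _))//; lra.
  move: h1 h2; rewrite !normr_le0 => /eqP h1 /eqP h2.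
  by rewrite /= h1 h2 subrr expr0n.
- move=> _ _; rewrite integral0; exact.
Qed.

(** Refining the step only increases the norm, and for fine steps the quotient is close in L^2 to
    the derivative. The constant 2 comes from [sqnD]; what matters is that it does not depend on
    [n]. *)
Lemma sqn_dquot_le_pderiv n psi : C1c psi ->
  (sqn (dquot (dyadic n) psi) <= 2%:E * sqn (pderiv k psi))%E.
Proof.
move=> cpsi; apply/lee_addgt0Pr => e e0.
have e20 : 0 < e / 2 by rewrite divr_gt0.
have /sqn_cvg0P/(_ _ e20) hn := sqn_dquot_C1c cpsi.
near \oo => p.
have np : (n <= p)%N by near: p; exact: nbhs_infty_ge.
apply: (le_trans (sqn_dquot_le np (C1c_measurable cpsi))).
have -> : dquot (dyadic p) psi = pderiv k psi \+ (dquot (dyadic p) psi \- pderiv k psi).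
  by apply/funext => x /=; rewrite addrC subrK.
apply: (le_trans (sqnD (C1c_measurable_pderiv cpsi) _)).
  apply: measurable_funB; last exact: C1c_measurable_pderiv.
  by apply: measurable_dquot; exact: C1c_measurable.
apply: leeD2l; have -> : e%:E = (2%:E * (e / 2)%:E)%E by rewrite -EFinM; congr EFin; field.
by rewrite lee_pmul2l//; near: p.
Unshelve. all: by end_near. Qed.

Lemma sqn_lty_cbox f (C M : R) : measurable_fun setT f ->
  (forall x, `|f x| <= C * \1_(cbox (const_mx (- M)) (const_mx M)) x) -> (sqn f < +oo)%E.
Proof.
set B := cbox _ _ => mf fC; have mB : measurable (B : set T) by exact: measurable_cbox.
have mI : measurable_fun setT (fun x : T => (\1_B x : R)%:E).
  by apply/measurable_EFinP; exact: measurable_indic.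
apply: (@le_lt_trans _ _ (\int[mu]_x ((C ^+ 2)%:E * (\1_B x)%:E))%E).
  apply: ge0_le_integral => //.
  - by move=> x _; rewrite lee_fin sqr_ge0.
  - exact: measurable_sqn.
  - exact: measurable_funeM.
  move=> x _; rewrite -EFinM lee_fin; have := fC x; rewrite indicE.
  case: (x \in B) => /=; rewrite ?mulr1 ?mulr0 => h.
    by rewrite -(real_normK (num_real (f x))) lerXn2r// nnegrE (le_trans _ h).
  by move: h; rewrite normr_le0 => /eqP ->; rewrite expr0n.
rewrite ge0_integralZl ?lee_fin ?sqr_ge0//.
rewrite integral_indic// setIT lte_mul_pinfty// ?lee_fin ?sqr_ge0//.
exact: cbox_lty.
Qed.

Lemma C1c_sqn_pderiv_lty psi : C1c psi -> (sqn (pderiv k psi) < +oo)%E.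
Proof.
move=> cpsi; have [C [M [_ _ _ hD]]] := C1c_dquot_bound cpsi.
exact: sqn_lty_cbox (C1c_measurable_pderiv cpsi) hD.
Qed.

Lemma C1c_sqn_lty psi : C1c psi -> (sqn psi < +oo)%E.
Proof.
move=> cpsi; have [cp _ _ [M M0 psiM]] := cpsi.
have := @continuous_compact _ _ _ _ (continuous_subspaceT cp)
  (@compact_cbox R N (const_mx (- M)) (const_mx M)).
move=> /compact_bounded[C [_ hC]].
apply: (@sqn_lty_cbox psi (`|C| + 1) M (C1c_measurable cpsi)) => x; rewrite indicE.
have [xM|xM] := pselect (cbox (const_mx (- M)) (const_mx M) x); last first.
  by rewrite memNset// mulr0 psiM// normr0.
rewrite mem_set// mulr1; apply: hC; last by exists x.
by rewrite (le_lt_trans (ler_norm _))// ltrDl.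
Qed.

(** For a fixed step the quotient is a bounded operator on L^2. The bound degenerates with h, but it
    allows passage to the limit in the function while the step is frozen. *)
Lemma sqn_dquot_coarse h f : h != 0 -> measurable_fun setT f ->
  (sqn (dquot h f) <= (4 / h ^+ 2)%:E * sqn f)%E.
Proof.
move=> h0 mf; have mf' := measurable_shift (h *: ek) mf.
have mc (c : R) (g : T -> R) : measurable_fun setT g -> measurable_fun setT (fun x => c * g x).
  by move=> mg; apply: measurable_funM => //; exact: measurable_cst.
have -> : dquot h f = (fun x => h^-1 * f (x + h *: ek)) \+ (fun x => - h^-1 * f x).
  by apply/funext => x; rewrite /dquot /=; field.
apply: (le_trans (sqnD (mc _ _ mf') (mc _ _ mf))).
have c1 : 0 <= 2 * h^-1 ^+ 2 by rewrite mulr_ge0// sqr_ge0.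
have c2 : 0 <= 2 * (- h^-1) ^+ 2 by rewrite mulr_ge0// sqr_ge0.
rewrite !sqnZ// (@sqn_shift (h *: ek) f)// !muleA -!EFinM -ge0_muleDl ?lee_fin//.
by rewrite -EFinD (_ : _ + _ = 4 / h ^+ 2)//; field.
Qed.

Lemma dquotB h f g : dquot h (f \- g) = dquot h f \- dquot h g.
Proof. by apply/funext => x; rewrite /dquot /=; ring. Qed.

(** The uniform bound for test functions is first extended to [psi j \- f] by approximation; then a
    test function close to [f] is inserted, for which convergence of the quotients is already
    known. *)
Lemma sqn_cvg_dquot f df (psi : nat -> T -> R) :
  measurable_fun setT f -> measurable_fun setT df -> (forall j, C1c (psi j)) ->
  sqn (psi j \- f) @[j --> \oo] --> 0%E ->
  sqn (pderiv k (psi j) \- df) @[j --> \oo] --> 0%E ->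
  sqn (dquot (dyadic n) f \- df) @[n --> \oo] --> 0%E.
Proof.
move=> mf mdf cpsi psif dpsif.
have sqnN (g g' : T -> R) : sqn (g \- g') = sqn (g' \- g).
  apply: eq_integral => x _; congr EFin; rewrite /=; ring.
have mpsi j := C1c_measurable (cpsi j).
have mdpsi j := C1c_measurable_pderiv (cpsi j).
(* [f] is replaced by [psi m], with [m] chosen after the step: the coarse bound absorbs the
   replacement, and the uniform bound applies to [psi j \- psi m]. The constant is 8 = 2 * 2 * 2,
   from two uses of [sqnD] and one of [sqn_dquot_le_pderiv]. *)
have step n j : (sqn (dquot (dyadic n) (psi j \- f)) <= 8%:E * sqn (pderiv k (psi j) \- df))%E.
  apply/lee_addgt0Pr => e e0.
  pose K : R := 2 * (4 / dyadic n ^+ 2).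
  have K0 : 0 < K by rewrite /K mulr_gt0// divr_gt0// exprn_gt0// dyadic_gt0.
  have e1 : 0 < e / 2 / K by rewrite !divr_gt0.
  have e2 : 0 < e / 16 by rewrite divr_gt0.
  have /sqn_cvg0P/(_ _ e1) h1 := psif.
  have /sqn_cvg0P/(_ _ e2) h2 := dpsif.
  near \oo => m.
  have [cB dB] := C1cB (cpsi j) (cpsi m).
  have -> : dquot (dyadic n) (psi j \- f) =
      dquot (dyadic n) (psi m \- f) \+ dquot (dyadic n) (psi j \- psi m).
    by apply/funext => x; rewrite /dquot /=; ring.
  apply: (le_trans (sqnD _ _)).
    by apply: measurable_dquot; exact: measurable_funB.
    by apply: measurable_dquot; exact: measurable_funB.
  have b1 : (2%:E * sqn (dquot (dyadic n) (psi m \- f)) <= (e / 2)%:E)%E.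
    apply: (@le_trans _ _ (2%:E * ((4 / dyadic n ^+ 2)%:E * sqn (psi m \- f)))%E).
      rewrite lee_pmul2l//; apply: sqn_dquot_coarse; first exact: dyadic_neq0.
      exact: measurable_funB.
    rewrite muleA -EFinM -/K.
    have -> : (e / 2)%:E = (K%:E * (e / 2 / K)%:E)%E.
      by rewrite -EFinM; congr EFin; field; rewrite gt_eqF.
    by rewrite lee_pmul2l ?lte_fin//; near: m.
  have b2 : (sqn (pderiv k (psi j) \- pderiv k (psi m)) <=
      2%:E * sqn (pderiv k (psi j) \- df) + (e / 8)%:E)%E.
    have -> : pderiv k (psi j) \- pderiv k (psi m) =
        (pderiv k (psi j) \- df) \+ (df \- pderiv k (psi m)).
      by apply/funext => x /=; ring.
    apply: (le_trans (sqnD _ _)); try exact: measurable_funB.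
    apply: leeD2l; rewrite sqnN.
    have -> : (e / 8)%:E = (2%:E * (e / 16)%:E)%E by rewrite -EFinM; congr EFin; field.
    by rewrite lee_pmul2l//; near: m.
  have b3 : (2%:E * sqn (dquot (dyadic n) (psi j \- psi m)) <=
     8%:E * sqn (pderiv k (psi j) \- df) + (e / 2)%:E)%E.
    apply: (@le_trans _ _ (2%:E * (2%:E * sqn (pderiv k (psi j \- psi m)%R)))%E).
      by rewrite lee_pmul2l//; exact: sqn_dquot_le_pderiv.
    rewrite dB muleA -EFinM.
    apply: (@le_trans _ _ ((2 * 2)%:E * (2%:E * sqn (pderiv k (psi j) \- df) + (e / 8)%:E))%E).
      by rewrite lee_pmul2l ?lte_fin.
    have e80 : 0 <= e / 8 by rewrite divr_ge0// ltW.
    rewrite ge0_muleDr ?mule_ge0 ?sqn_ge0 ?lee_fin// muleA -!EFinM.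
    have -> : 2 * 2 * 2 = 8 :> R by ring.
    have -> : 2 * 2 * (e / 8) = e / 2 by field.
    exact: lexx.
  apply: (le_trans (leeD b1 b3)).
  have eE : e / 2 + e / 2 = e by field.
  by rewrite addeC -addeA -EFinD eE.
apply/sqn_cvg0P => e e0.
(* The three pieces of the decomposition below add up to 2 * 8 * e / 40 + 4 * e / 8 + 4 * e / 40 =
   e. *)
have e1 : 0 < e / 40 by rewrite divr_gt0.
have e2 : 0 < e / 8 by rewrite divr_gt0.
have /sqn_cvg0P/(_ _ e1) h1 := dpsif.
near \oo => j.
have /sqn_cvg0P/(_ _ e2) h2 := sqn_dquot_C1c (cpsi j).
near=> n.
have -> : dquot (dyadic n) f \- df = dquot (dyadic n) (f \- psi j) \+
   ((dquot (dyadic n) (psi j) \- pderiv k (psi j)) \+ (pderiv k (psi j) \- df)).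
  by apply/funext => x; rewrite /dquot /=; ring.
have mq g : measurable_fun setT g -> measurable_fun setT (dquot (dyadic n) g).
  exact: measurable_dquot.
apply: (le_trans (sqnD _ _)).
- by apply: mq; exact: measurable_funB.
- apply: measurable_funD; apply: measurable_funB => //; exact: mq.
have b1 : (sqn (pderiv k (psi j) \- df) <= (e / 40)%:E)%E by near: j.
have b2 : (sqn (dquot (dyadic n) (psi j) \- pderiv k (psi j)) <= (e / 8)%:E)%E by near: n.
have b3 : (sqn (dquot (dyadic n) (f \- psi j)) <= (8 * (e / 40))%:E)%E.
  rewrite dquotB sqnN -dquotB; apply: (le_trans (step n j)).
  by rewrite [leRHS]EFinM lee_pmul2l.
have b4 : (sqn ((dquot (dyadic n) (psi j) \- pderiv k (psi j))%R \+ (pderiv k (psi j) \- df)%R)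
    <= (2 * (e / 8) + 2 * (e / 40))%:E)%E.
  apply: (le_trans (sqnD _ _)).
  - by apply: measurable_funB => //; exact: mq.
  - exact: measurable_funB.
  by rewrite [leRHS]EFinD [in leRHS]EFinM [X in (_ <= _ + X)%E]EFinM; apply: leeD; rewrite lee_pmul2l.
apply: (@le_trans _ _ ((2 * (8 * (e / 40)))%:E + (2 * (2 * (e / 8) + 2 * (e / 40)))%:E)%E).
  by rewrite ![in leRHS]EFinM; apply: leeD; rewrite lee_pmul2l//.
by rewrite -EFinD lee_fin; lra.
Unshelve. all: by end_near. Qed.

End difference_quotients.

(** * Integrable majorants and summable subsequences *)

Section L2_tools.
Context {R : realType} {N : nat}.
Local Notation T := 'rV[R]_N.
Local Notation mu := (lebesgue_rV R N).
Implicit Types (f g : T -> R).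

Lemma integrable_le_abs f (H : T -> \bar R) : measurable_fun setT f ->
  (forall x, (`|f x|%:E <= H x)%E) -> mu.-integrable setT H ->
  mu.-integrable setT (EFin \o f).
Proof.
move=> mf fH iH; apply: (le_integrable measurableT _ _ iH).
  exact/measurable_EFinP.
by move=> x _ /=; apply: le_trans (fH x) _; exact: lee_abs.
Qed.

Lemma integrable_sqr f : measurable_fun setT f -> (sqn f < +oo)%E ->
  mu.-integrable setT (fun x => (f x ^+ 2)%:E).
Proof.
move=> mf foo; apply/integrableP; split; first exact: measurable_sqn.
under eq_integral do rewrite gee0_abs ?lee_fin ?sqr_ge0//.
exact: foo.
Qed.

Lemma integrable_mul f g : measurable_fun setT f -> measurable_fun setT g ->
  (sqn f < +oo)%E -> (sqn g < +oo)%E ->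
  mu.-integrable setT (fun x => (f x * g x)%:E).
Proof.
move=> mf mg foo goo.
apply: (integrable_le_abs (H := fun x => ((f x ^+ 2)%:E + (g x ^+ 2)%:E)%E)).
- exact: measurable_funM.
- move=> x; rewrite -EFinD lee_fin normrM.
  have := sqr_ge0 (`|f x| - `|g x|); rewrite -(real_normK (num_real (f x))) -(real_normK (num_real (g x))).
  set a := `|f x|; set b := `|g x|.
  have := sqr_ge0 a; have := sqr_ge0 b; lra.
- by apply: integrableD => //; exact: integrable_sqr.
Qed.

Lemma sqn_lty_le f (H : T -> \bar R) : measurable_fun setT f ->
  (forall x, ((f x ^+ 2)%:E <= H x)%E) -> mu.-integrable setT H -> (sqn f < +oo)%E.
Proof.
move=> mf fH /integrableP[mH Hoo].
apply: le_lt_trans Hoo; apply: ge0_le_integral => //.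
- by move=> x _; rewrite lee_fin sqr_ge0.
- exact: measurable_sqn.
- exact: measurableT_comp.
- by move=> x _; apply: le_trans (fH x) _; exact: lee_abs.
Qed.

Lemma integrable_indic_lty (B : set T) : measurable B -> (mu B < +oo)%E ->
  mu.-integrable setT (fun x => (\1_B x)%:E).
Proof.
move=> mB Boo; apply/integrableP; split.
  by apply/measurable_EFinP; exact: measurable_indic.
under eq_integral do rewrite gee0_abs ?lee_fin//.
by rewrite integral_indic// setIT.
Qed.

(** Terms below 2^-(j+1) are picked. The indices need not increase; [j <= n_ j] is enough to make
    the steps [dyadic (n_ j)] tend to 0. *)
Lemma summable_subsequence (u : nat -> \bar R) : (forall n, 0 <= u n)%E ->
  u n @[n --> \oo] --> 0%E ->
  exists n_ : nat -> nat, (forall j, (j <= n_ j)%N) /\ (\sum_(j <oo) u (n_ j) < +oo)%E.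
Proof.
move=> u0 /(nneg_cvg0P u0) ucvg.
have h j : exists n, (j <= n)%N /\ (u n <= (1 / (2 ^ j.+1)%:R)%:E)%E.
  have := ucvg (1 / (2 ^ j.+1)%:R); rewrite divr_gt0 ?ltr0n ?expn_gt0// => /(_ isT) hj.
  near \oo => n; exists n; split; last by near: n.
  by near: n; exact: nbhs_infty_ge.
have [n_ hn] := choice h.
exists n_; split; first by move=> j; have [] := hn j.
apply: (@le_lt_trans _ _ (\sum_(j <oo) (1 / (2 ^ j.+1)%:R)%:E)%E).
  by apply: lee_nneseries => [j _ _|j _]; [exact: u0|have [] := hn j].
by apply: le_lt_trans (ltry 1); exact: epsilon_trick0.
Unshelve. all: by end_near. Qed.

(** Applied pointwise to the errors of the quotients, a single finite sum yields both convergence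
    and domination. *)
Lemma nneseries_terms (u : nat -> R) : (forall n, 0 <= u n) ->
  (\sum_(j <oo) (u j)%:E < +oo)%E ->
  u n @[n --> \oo] --> 0 /\ forall n, ((u n)%:E <= \sum_(j <oo) (u j)%:E)%E.
Proof.
move=> u0 uoo.
have u0' (n : nat) : (0 <= (u n)%:E)%E by rewrite lee_fin.
have term n : ((u n)%:E <= \sum_(n <= j <oo) (u j)%:E)%E.
  have := @nneseries_lim_ge R (fun j => (u j)%:E) xpredT n n.+1 (fun j _ _ => u0' j).
  by rewrite big_nat1.
split=> [|n]; last first.
  apply: (le_trans (term n)).
  rewrite (@nneseries_split _ _ 0 n) ?add0n => [|j _]; last exact: u0'.
  by rewrite leeDr// sume_ge0.
have tail := nneseries_tail_cvg uoo (fun j _ => u0' j).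
have : (u n)%:E @[n --> \oo] --> 0%E.
  apply: (squeeze_cvge _ (cvg_cst 0%E) tail); apply: nearW => n.
  by rewrite u0' term.
by move=> /fine_cvgP[].
Qed.

End L2_tools.

(** * Weak gradient of the radial map *)

Section radial_chain_rule.
Context {R : realType} {N : nat} (k : 'I_N) (I : finType).
Local Notation T := 'rV[R]_N.
Local Notation mu := (lebesgue_rV R N).
Variables (phi : R -> R) (delta : R).
Local Notation rho := (fun s : R => Num.sqrt (phi s)).
Hypothesis phi0 : forall s : R, 0 < s -> 0 < phi s.
Hypothesis phi' : forall s : R, 0 < s -> derivable phi s 1.
Hypothesis delta01 : 0 < delta <= 1.
Hypothesis elliptic : forall s : R, 0 < s ->
  delta * (2 * phi s + s * derive1 phi s) ^+ 2 <= 4 * phi s * (phi s + s * derive1 phi s).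
Variables (u w du dw : I -> T -> R).
Hypothesis wE : forall i x, w i x = radial phi (u^~ x) i.
Hypothesis meas_u : forall i, measurable_fun setT (u i).
Hypothesis meas_w : forall i, measurable_fun setT (w i).
Hypothesis meas_du : forall i, measurable_fun setT (du i).
Hypothesis meas_dw : forall i, measurable_fun setT (dw i).
Hypothesis u2 : forall i, (sqn (u i) < +oo)%E.
Hypothesis w2 : forall i, (sqn (w i) < +oo)%E.
Hypothesis du2 : forall i, (sqn (du i) < +oo)%E.
Hypothesis dw2 : forall i, (sqn (dw i) < +oo)%E.

Definition radial_comp (i : I) (x : T) : R := radial rho (u^~ x) i.
Local Notation v := radial_comp.

(** |V(u)|^2 = <u, W(u)> is what places V(u) in L^2: the right-hand side is a product of L^2
    functions. *)
Lemma ip_radial_comp x : ip (v^~ x) (v^~ x) = ip (u^~ x) (w^~ x).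
Proof.
rewrite (_ : w^~ x = radial phi (u^~ x)); last by apply/funext => i; exact: wE.
rewrite /radial_comp /radial !ipZl !ipZr mulrA.
have [/nrm_eq0 c0|c0] := eqVneq (nrm (u^~ x)) 0.
  by rewrite /ip big1 ?mulr0// => i _; rewrite c0 mul0r.
by rewrite -expr2 sqr_sqrtr// ltW// phi0// lt_def c0 nrm_ge0.
Qed.

(** Nothing is known about [phi] on the nonpositive half-line, so it is cut off to 0 there. The
    result does not change, since [u] vanishes wherever its norm does. *)
Lemma measurable_radial_comp i : measurable_fun setT (v i).
Proof.
pose phi1 (t : R) : R := if 0 < t then phi t else 0.
have mphi1 : measurable_fun setT phi1.
  apply: measurable_fun_if => //; first exact: measurable_fun_ltr.
  rewrite setTI (_ : _ @^-1` _ = `]0, +oo[%classic); last first.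
    by apply/seteqP; split => t /=; rewrite in_itv/= andbT.
  apply: open_continuous_measurable_fun; first exact: interval_open.
  move=> t; rewrite inE/= in_itv/= andbT => t0.
  by apply/differentiable_continuous/derivable1_diffP; exact: phi'.
have mnrm : measurable_fun setT (fun x => nrm (u^~ x)).
  apply: (measurableT_comp (continuous_measurable_fun (@sqrt_continuous R))).
  apply: measurable_sum => j; exact: measurable_funM.
have -> : v i = fun x => Num.sqrt (phi1 (nrm (u^~ x))) * u i x.
  apply/funext => x; rewrite /radial_comp /radial /phi1.
  have [/nrm_eq0 c0|c0] := eqVneq (nrm (u^~ x)) 0; first by rewrite c0 !mulr0.
  by rewrite lt_def c0 nrm_ge0.
apply: measurable_funM => //.
apply: (measurableT_comp (continuous_measurable_fun (@sqrt_continuous R))).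
exact: measurableT_comp.
Qed.

Lemma integrable_ip (a b : I -> T -> R) :
  (forall i, measurable_fun setT (a i)) -> (forall i, measurable_fun setT (b i)) ->
  (forall i, sqn (a i) < +oo)%E -> (forall i, sqn (b i) < +oo)%E ->
  mu.-integrable setT (fun x => (ip (a^~ x) (b^~ x))%:E).
Proof.
move=> ma mb a2 b2.
under eq_fun do rewrite /ip -sumEFin.
by apply: integrable_sum => // i _; exact: integrable_mul.
Qed.

Lemma sqn_radial_comp i : (sqn (v i) < +oo)%E.
Proof.
apply: (sqn_lty_le (measurable_radial_comp i) _ (integrable_ip meas_u meas_w u2 w2)) => x.
rewrite lee_fin -ip_radial_comp /ip (bigD1 i)//= -expr2 lerDl.
by apply: sumr_ge0 => j _; rewrite -expr2 sqr_ge0.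
Qed.

Hypothesis cu : forall i, sqn (dquot k (dyadic n) (u i) \- du i) @[n --> \oo] --> 0%E.
Hypothesis cw : forall i, sqn (dquot k (dyadic n) (w i) \- dw i) @[n --> \oo] --> 0%E.

(** One scalar function controls the errors of all components of u and W(u) together, so a single
    subsequence serves for all of them. *)
Let err (n : nat) (x : T) : R := \sum_i
  (((dquot k (dyadic n) (u i) \- du i) x) ^+ 2 + ((dquot k (dyadic n) (w i) \- dw i) x) ^+ 2).

Let err_ge0 n x : 0 <= err n x.
Proof. by apply: sumr_ge0 => i _; rewrite addr_ge0// sqr_ge0. Qed.

Let mdqu n i : measurable_fun setT (dquot k (dyadic n) (u i) \- du i).
Proof. by apply: measurable_funB => //; exact: measurable_dquot. Qed.

Let mdqw n i : measurable_fun setT (dquot k (dyadic n) (w i) \- dw i).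
Proof. by apply: measurable_funB => //; exact: measurable_dquot. Qed.

Let merr n : measurable_fun setT (err n).
Proof.
apply: measurable_sum => i; apply: measurable_funD; exact: measurable_funX.
Qed.

Let int_err n : (\int[mu]_x (err n x)%:E = \sum_i
   (sqn (dquot k (dyadic n) (u i) \- du i)%R + sqn (dquot k (dyadic n) (w i) \- dw i)%R))%E.
Proof.
under eq_integral do rewrite /err -sumEFin.
rewrite ge0_integral_sum//; first last.
- by move=> i x _; rewrite lee_fin addr_ge0// sqr_ge0.
- move=> i; apply/measurable_EFinP; apply: measurable_funD; exact: measurable_funX.
apply: eq_bigr => i _; under eq_integral do rewrite EFinD.
rewrite ge0_integralD//; first last.
- exact: measurable_sqn.
- by move=> x _; rewrite lee_fin sqr_ge0.
- exact: measurable_sqn.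
- by move=> x _; rewrite lee_fin sqr_ge0.
Qed.

Let cvg_int_err : (\int[mu]_x (err n x)%:E)%E @[n --> \oo] --> 0%E.
Proof.
under eq_fun do rewrite int_err.
have z : (\sum_(i : I) (0 + 0) = 0 :> \bar R)%E by rewrite big1// => i _; rewrite adde0.
have := @cvg_nnesum nat \oo _ R I (index_enum I)
  (fun i n => (sqn (dquot k (dyadic n) (u i) \- du i)%R + sqn (dquot k (dyadic n) (w i) \- dw i)%R)%E)
  (fun=> (0 + 0)%E) xpredT.
rewrite z; apply => i _; first by apply: nearW => n; rewrite adde_ge0// sqn_ge0.
by apply: cvgeD => //.
Qed.

Lemma radial_chain_rule : exists g : I -> T -> R,
  [/\ forall i, measurable_fun setT (g i),
      forall i, (sqn (g i) < +oo)%E,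
      {ae mu, forall x, delta * ip (g^~ x) (g^~ x) <= ip (du^~ x) (dw^~ x)
                        <= ip (g^~ x) (g^~ x)} &
      forall i psi, C1c k psi ->
        \int[mu]_x (v i x * pderiv k psi x) = - \int[mu]_x (g i x * psi x)].
Proof.
have [n_ [n_ge Soo]] := summable_subsequence
  (fun n => integral_ge0 mu (fun x _ => err_ge0 n x : (0 <= (err n x)%:E)%E)) cvg_int_err.
pose h (j : nat) : R := dyadic (n_ j).
have h0 j : h j != 0 by exact: dyadic_neq0.
have hcvg : h j @[j --> \oo] --> (0 : R).
  apply: (squeeze_cvgr _ (cvg_cst 0) (@cvg_dyadic R)); apply: nearW => j.
  rewrite ltW ?dyadic_gt0//= /h /dyadic; apply: ler_wiXn2l => //.
  by rewrite invf_le1// ler1n.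
(* The sum of the errors along the subsequence is integrable, hence finite almost everywhere. Where
   it is finite the quotients of u and W(u) converge, and it dominates every error. *)
pose S (x : T) : \bar R := (\sum_(j <oo) (err (n_ j) x)%:E)%E.
have S0 x : (0 <= S x)%E by apply: nneseries_ge0 => j _ _; rewrite lee_fin.
have mS : measurable_fun setT S.
  by apply: ge0_emeasurable_sum => [j x _ _|j _]; [rewrite lee_fin|exact/measurable_EFinP].
have iS : mu.-integrable setT S.
  apply/integrableP; split => //.
  under eq_integral do rewrite gee0_abs//.
  rewrite integral_nneseries//; last by move=> j x _; rewrite lee_fin.
  by move=> j; exact/measurable_EFinP.
pose good : set T := [set x | (S x < +oo)%E].
have mgood : measurable good.
  by rewrite -[X in measurable X]setTI; exact: emeasurable_fun_infty_o.
have aegood : {ae mu, forall x, good x}.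
  have := integrable_ae measurableT iS; apply: filterS => x /(_ Logic.I)/fin_numP[_ Sx].
  by rewrite /good /= ltey.
have err0 x : good x -> err (n_ j) x @[j --> \oo] --> 0.
  by move=> gx; have [] := nneseries_terms (fun j => err_ge0 (n_ j) x) gx.
have errS x j : good x -> ((err (n_ j) x)%:E <= S x)%E.
  by move=> gx; have [_] := nneseries_terms (fun j => err_ge0 (n_ j) x) gx; exact.
have uerr n i x : ((dquot k (dyadic n) (u i) \- du i) x) ^+ 2 <= err n x.
  rewrite /err (bigD1 i)//= -addrA lerDl addr_ge0 ?sqr_ge0//.
  by apply: sumr_ge0 => j _; rewrite addr_ge0// sqr_ge0.
have werr n i x : ((dquot k (dyadic n) (w i) \- dw i) x) ^+ 2 <= err n x.
  rewrite /err (bigD1 i)//= addrAC lerDr addr_ge0 ?sqr_ge0//.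
  by apply: sumr_ge0 => j _; rewrite addr_ge0// sqr_ge0.
have sqr_cvg0 (a : nat -> R) (b : nat -> R) (l : R) : (forall j, (a j - l) ^+ 2 <= b j) ->
    b j @[j --> \oo] --> 0 -> a j @[j --> \oo] --> l.
  move=> ab b0; apply/cvgrPdist_le => e e0.
  have e20 : 0 < e ^+ 2 by rewrite exprn_gt0.
  near=> j; rewrite distrC -(@ler_pXn2r _ 2)// ?nnegrE ?(ltW e0)//.
  rewrite real_normK ?num_real// (le_trans (ab j))//.
  by near: j; exact: (cvgr_le _ b0).
have ucvg x i : good x -> dquot k (h j) (u i) x @[j --> \oo] --> du i x.
  by move=> gx; apply: sqr_cvg0 (err0 x gx) => j; exact: uerr.
have wcvg x i : good x -> dquot k (h j) (w i) x @[j --> \oo] --> dw i x.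
  by move=> gx; apply: sqr_cvg0 (err0 x gx) => j; exact: werr.
(* Multiplication by the indicator of [good] makes the quotients of V(u) converge at every point, so
   the limit is measurable without any modification on a null set. *)
pose f j i (x : T) : R := dquot k (h j) (v i) x * \1_good x.
have mf j i : measurable_fun setT (f j i).
  apply: measurable_funM; last exact: measurable_indic.
  by apply: measurable_dquot; exact: measurable_radial_comp.
have fz x : exists z : I -> R, forall i, f j i x @[j --> \oo] --> z i.
  have [gx|gx] := pselect (good x); last first.
    exists (fun=> 0) => i; under eq_fun do rewrite /f indicE memNset// mulr0.
    exact: cvg_cst.
  have [i||z hz] := @radial_cvg_diff_quotient R phi phi0 phi' I (u^~ x)
    (fun j => u^~ (x + h j *: delta_mx ord0 k)) h (du^~ x) (dw^~ x) h0 hcvg.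
  - exact: ucvg.
  - by move=> i; have := wcvg x i gx; rewrite /dquot; under eq_fun do rewrite !wE.
  exists z => i; have := hz i; rewrite /f indicE mem_set//.
  by under [in X in _ -> X]eq_fun do rewrite mulr1.
have [g0 gP] := choice fz.
pose g i x := g0 x i.
have fg i x : f j i x @[j --> \oo] --> g i x by exact: gP.
have mg i : measurable_fun setT (g i).
  by apply: (@measurable_fun_cvg _ _ _ _ (fun j => f j i)) => // x _; exact: fg.
have [d0 d1] := andP delta01.
have ineq x : good x ->
    delta * ip (g^~ x) (g^~ x) <= ip (du^~ x) (dw^~ x) <= ip (g^~ x) (g^~ x).
  move=> gx.
  apply: (@radial_diff_quotient_limits R phi delta phi0 phi' delta01 elliptic I (u^~ x)
    (fun j => u^~ (x + h j *: delta_mx ord0 k)) h) => //.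
  - by move=> i; exact: ucvg.
  - by move=> i; have := wcvg x i gx; rewrite /dquot; under eq_fun do rewrite !wE.
  - move=> i; have := fg i x; rewrite /f indicE mem_set//.
    by under [in X in X -> _]eq_fun do rewrite mulr1.
(* Monotonicity gives delta |qv|^2 <= <qu, qw> <= (|qu|^2 + |qw|^2) / 2 for the quotients, and q^2
   <= 2 d^2 + 2 (q - d)^2 compares a quotient with its limit; the factors 2 and 1/2 cancel. *)
pose H (x : T) : \bar R := (delta^-1%:E *
  ((ip (du^~ x) (du^~ x))%:E + (ip (dw^~ x) (dw^~ x))%:E + S x))%E.
have iH : mu.-integrable setT H.
  apply: integrableZl => //; apply: integrableD => //.
  by apply: integrableD => //; exact: integrable_ip.
have H0 x : (0 <= H x)%E.
  by rewrite mule_ge0 ?lee_fin ?invr_ge0 ?(ltW d0)// !adde_ge0// lee_fin ip_ge0.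
have fH j i x : (((f j i x) ^+ 2)%:E <= H x)%E.
  have [gx|gx] := pselect (good x); last first.
    by rewrite /f indicE memNset// mulr0 expr0n.
  apply: (@le_trans _ _ (delta^-1 *
      (ip (du^~ x) (du^~ x) + ip (dw^~ x) (dw^~ x) + err (n_ j) x))%:E); last first.
    rewrite EFinM lee_pmul2l ?lte_fin ?invr_gt0// EFinD EFinD leeD2l//.
    exact: errS.
  rewrite lee_fin /f indicE mem_set// mulr1 ler_pdivlMl//.
  pose qv i := dquot k (h j) (v i) x.
  pose qu i := dquot k (h j) (u i) x.
  pose qw i := dquot k (h j) (w i) x.
  have le1 : qv i ^+ 2 <= ip qv qv.
    rewrite /ip (bigD1 i)//= -expr2 lerDl.
    by apply: sumr_ge0 => i' _; rewrite -expr2 sqr_ge0.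
  have le2 : delta * ip qv qv <= ip qu qw.
    have := radial_monotone phi0 phi' delta01 elliptic
      (u^~ (x + h j *: delta_mx ord0 k)) (u^~ x).
    have hE (a b : I -> R) : ip a b = h j ^+ 2 *
        ip (fun i => a i / h j) (fun i => b i / h j).
      by rewrite /ip mulr_sumr; apply: eq_bigr => i' _; field; exact: h0.
    rewrite hE [leRHS]hE mulrCA ler_pM2l; last first.
      by rewrite lt_def sqrf_eq0 h0 sqr_ge0.
    rewrite (_ : (fun i => (radial phi _ \- _) i / _) = qw)//.
    by apply/funext => i'; rewrite /qw /dquot !wE.
  have le3 : ip qu qw <= (ip qu qu + ip qw qw) / 2 := ip_le_sqr _ _.
  have le4 : ip qu qu + ip qw qw <= 2 * (ip (du^~ x) (du^~ x) + ip (dw^~ x) (dw^~ x) + err (n_ j) x).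
    rewrite /ip /err -!big_split/= mulr_sumr; apply: ler_sum => i' _.
    rewrite -/(h j) -/(qu i') -/(qw i').
    have := sqr_ge0 (qu i' - 2 * du i' x); have := sqr_ge0 (qw i' - 2 * dw i' x).
    by lra.
  have : delta * qv i ^+ 2 <= delta * ip qv qv by rewrite ler_pM2l.
  by rewrite -/(qv i); lra.
exists g; split => //.
- move=> i; have := @dominated_convergence _ _ _ mu setT measurableT
    (fun j x => ((f j i x) ^+ 2)%:E) (fun x => ((g i x) ^+ 2)%:E) H.
  case.
  + by move=> j; exact: measurable_sqn.
  + exact: measurable_sqn.
  + apply: nearW => x _; apply: cvg_EFin; first exact: nearW.
    exact: (cvg_comp _ (fun y : R => y ^+ 2) (fg i x) (@exprn_continuous _ 2 _)).
  + exact: iH.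
  + by apply: nearW => x j _; rewrite gee0_abs ?lee_fin ?sqr_ge0.
  + move=> /integrableP[_ +] _ _; rewrite /sqn.
    by under eq_integral do rewrite gee0_abs ?lee_fin ?sqr_ge0//.
- by apply: filterS aegood => x; exact: ineq.
move=> i psi cpsi.
have mpsi := C1c_measurable cpsi.
have mdpsi := C1c_measurable_pderiv cpsi.
have [C [M [M0 C0 hC hD]]] := C1c_dquot_bound cpsi.
pose B : set T := cbox (const_mx (- M)) (const_mx M).
have mB : measurable B by exact: measurable_cbox.
have iB : mu.-integrable setT (fun x => (C ^+ 2 * \1_B x)%:E).
  under eq_fun do rewrite EFinM; apply: integrableZl => //.
  exact: integrable_indic_lty (cbox_lty _ _).
have psi2 : (sqn psi < +oo)%E by exact: C1c_sqn_lty cpsi.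
have mv := measurable_radial_comp i.
have v2 := sqn_radial_comp i.
have iv2 := integrable_sqr mv v2.
have lim1 : (\int[mu]_x (f j i x * psi x)%:E)%E @[j --> \oo] -->
    (\int[mu]_x (g i x * psi x)%:E)%E.
  have [//|||||_ _ //] := @dominated_convergence _ _ _ mu setT measurableT
    (fun j x => (f j i x * psi x)%:E) (fun x => (g i x * psi x)%:E)
    (fun x => H x + (psi x ^+ 2)%:E)%E.
  + by move=> j; apply/measurable_EFinP; exact: measurable_funM.
  + by apply/measurable_EFinP; exact: measurable_funM.
  + apply: nearW => x _; apply: cvg_EFin; first exact: nearW.
    by apply: cvgM; [exact: fg|exact: cvg_cst].
  + by apply: integrableD => //; exact: integrable_sqr.
  + apply: nearW => x j _; apply: (@le_trans _ _ ((f j i x ^+ 2)%:E + (psi x ^+ 2)%:E)%E).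
      rewrite -EFinD lee_fin normrM.
      rewrite -(real_normK (num_real (f j i x))) -(real_normK (num_real (psi x))).
      set a := `|_|; set b := `|psi x|.
      by have := sqr_ge0 (a - b); have := sqr_ge0 a; have := sqr_ge0 b; lra.
    by apply: leeD2r; exact: fH.
have lim2 : (\int[mu]_x (v i x * dquot k (- h j) psi x)%:E)%E @[j --> \oo] -->
    (\int[mu]_x (v i x * pderiv k psi x)%:E)%E.
  have mq j : measurable_fun setT (dquot k (- h j) psi) by exact: measurable_dquot.
  have [//|||||_ _ //] := @dominated_convergence _ _ _ mu setT measurableT
    (fun j x => (v i x * dquot k (- h j) psi x)%:E) (fun x => (v i x * pderiv k psi x)%:E)
    (fun x => (v i x ^+ 2)%:E + (C ^+ 2 * \1_B x)%:E)%E.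
  + by move=> j; apply/measurable_EFinP; exact: measurable_funM.
  + by apply/measurable_EFinP; exact: measurable_funM.
  + apply: nearW => x _; apply: cvg_EFin; first exact: nearW.
    apply: cvgM; first exact: cvg_cst.
    apply: (@cvg_dquot _ _ _ psi (fun j => - h j)).
    * by case: cpsi.
    * by move=> j; rewrite oppr_eq0 h0.
    * by rewrite -oppr0; exact: cvgN.
  + exact: integrableD.
  + apply: nearW => x j _; rewrite -EFinD lee_fin normrM.
    have := hC (- h j) x; rewrite oppr_eq0 normrN => /(_ (h0 j)).
    rewrite (ger0_norm (ltW (dyadic_gt0 (n_ j)))) => /(_ (dyadic_le1 (n_ j))).
    rewrite -/B indicE -(real_normK (num_real (v i x))).
    set a := `|v i x|; set b := `|_|; have b0 : 0 <= b by exact: normr_ge0.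
    have a0 := sqr_ge0 a.
    case: (x \in B); rewrite ?mulr1 ?mulr0 => bC.
      have : b ^+ 2 <= C ^+ 2 by rewrite lerXn2r// nnegrE.
      by have := sqr_ge0 (a - b); have := sqr_ge0 b; lra.
    have -> : b = 0 by apply/eqP; rewrite eq_le bC b0.
    by rewrite mulr0 addr0.
(* Summation by parts: translation moves the quotient with step h from V(u) to the test function,
   where it becomes the quotient with step - h. *)
have lim_eq j : (\int[mu]_x (f j i x * psi x)%:E =
    - \int[mu]_x (v i x * dquot k (- h j) psi x)%:E)%E.
  have mvs c := measurable_shift c mv.
  have v2s (c : T) : (sqn (fun x => v i (x + c)%R) < +oo)%E by rewrite sqn_shift.
  have mps c := measurable_shift c mpsi.
  have p2s (c : T) : (sqn (fun x => psi (x + c)%R) < +oo)%E by rewrite sqn_shift.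
  set c := h j *: (delta_mx ord0 k : T).
  transitivity (\int[mu]_x ((h j)^-1%:E * ((v i (x + c) * psi x)%:E - (v i x * psi x)%:E)))%E.
    apply: ae_eq_integral => //.
    - by apply/measurable_EFinP; exact: measurable_funM.
    - apply: measurable_funeM; apply: emeasurable_funB;
        by apply/measurable_EFinP; exact: measurable_funM.
    - apply: filterS aegood => x gx _; rewrite /f indicE mem_set// mulr1 /dquot.
      by rewrite -EFinB -EFinM -/c; congr EFin; ring.
  transitivity (- \int[mu]_x ((- (h j)^-1)%:E *
     ((v i x * psi (x - c))%:E - (v i x * psi x)%:E)))%E; last first.
    congr (- _)%E; apply: eq_integral => x _.
    rewrite -EFinB -EFinM /dquot scaleNr -/c; congr EFin.
    by rewrite invrN; ring.
  have i1 : mu.-integrable setT (fun x => (v i (x + c) * psi x)%:E).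
    exact: integrable_mul.
  have i2 : mu.-integrable setT (fun x => (v i x * psi x)%:E).
    exact: integrable_mul.
  have i3 : mu.-integrable setT (fun x => (v i x * psi (x - c))%:E).
    exact: integrable_mul.
  rewrite !integralZl//; [|exact: integrableB|exact: integrableB].
  rewrite !integralB//.
  have -> : (\int[mu]_x (v i (x + c) * psi x)%:E =
      \int[mu]_x (v i x * psi (x - c))%:E)%E.
    have := @integrable_integral_shift _ _ c (fun x => (v i x * psi (x - c))%:E) i3.
    move=> <-; apply: eq_integral => x _; by rewrite addrK.
  by rewrite EFinN mulNe oppeK.
have E : (\int[mu]_x (g i x * psi x)%:E = - \int[mu]_x (v i x * pderiv k psi x)%:E)%E.
  have lim3 : (\int[mu]_x (f j i x * psi x)%:E)%E @[j --> \oo] -->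
      (- \int[mu]_x (v i x * pderiv k psi x)%:E)%E.
    by rewrite (funext lim_eq); exact: cvgeN.
  exact: (cvg_unique _ lim1 lim3).
by rewrite /Rintegral E fineN opprK.
Unshelve. all: by end_near. Qed.

End radial_chain_rule.

(** * Fundamental lemma of the calculus of variations *)

Section flat_functions.
Context {R : realType}.
Implicit Types (x t : R).

(** x^-n exp(- 1 / x) for x > 0, extended by 0. The exponent [n] is kept because differentiation of
    exp(- 1 / x) produces exactly such powers, so the family is closed under it up to linear
    combinations. *)
Definition flat (n : nat) (x : R) : R :=
  if 0 < x then (x^-1) ^+ n * expR (- x^-1) else 0.

Lemma flat_le0 n x : x <= 0 -> flat n x = 0.
Proof. by rewrite /flat leNgt => /negbTE ->. Qed.

Lemma flat_ge0 n x : 0 <= flat n x.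
Proof.
by rewrite /flat; case: ifPn => // x0; rewrite mulr_ge0 ?expR_ge0// exprn_ge0// invr_ge0 ltW.
Qed.

Lemma flat0_le1 x : flat 0 x <= 1.
Proof.
rewrite /flat; case: ifPn => // x0.
by rewrite expr0 mul1r -expR0 ler_expR oppr_le0 invr_ge0 ltW.
Qed.

(** With y = 1 / x this is y^(n+2) <= (n+2)! exp(y), a single term of the exponential series. A
    quadratic bound makes the derivative at 0 exist and vanish. *)
Lemma flat_le_sqr n x : `|flat n x| <= (n.+2)`!%:R * x ^+ 2.
Proof.
rewrite ger0_norm ?flat_ge0// /flat; case: ifPn => x0; last first.
  by rewrite mulr_ge0// sqr_ge0.
set y := x^-1; have y0 : 0 < y by rewrite invr_gt0.
have h : y ^+ n.+2 <= (n.+2)`!%:R * expR y.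
  have := @expR_ge1Dxn R y n.+1 (ltW y0) => h.
  have f0 : 0 < (n.+2)`!%:R :> R by rewrite ltr0n fact_gt0.
  rewrite -ler_pdivrMl// mulrC; apply: le_trans h; by rewrite lerDr.
have xE : x = y^-1 by rewrite invrK.
rewrite xE expRN -ler_pdivrMr ?exprn_gt0 ?invr_gt0//.
clearbody y; rewrite exprVn invrK mulrAC -exprD addn2 ler_pdivrMr ?expR_gt0//.
Qed.

Lemma is_derive_flat n x : is_derive x 1 (flat n) (flat n.+2 x - n%:R * flat n.+1 x).
Proof.
have [x0|x0|->] := ltgtP x 0.
- rewrite !flat_le0 ?ltW// mulr0 subr0.
  apply: (@near_eq_is_derive _ _ _ (cst 0)).
  near=> t; rewrite flat_le0// ltW//; near: t; exact: lt_nbhsl.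
- pose g (y : R) : R := y ^+ n * expR (- y).
  have dg : is_derive x^-1 1 g (n%:R * x^-1 ^+ n.-1 * expR (- x^-1) - x^-1 ^+ n * expR (- x^-1)).
    have e1 : is_derive x^-1 1 (id ^+ n : R -> R) _ := is_deriveX n (is_derive_id _ _).
    have e2 := is_derive1_comp (is_derive_expR (- x^-1)) (is_deriveN (is_derive_id x^-1 (1 : R))).
    have -> : g = (id ^+ n : R -> R) * (expR \o (- id)) by apply/funext => y; rewrite /g !fctE.
    apply: (is_derive_eq (is_deriveM e1 e2)).
    by rewrite /GRing.scale/= !fctE /=; ring.
  have di : is_derive x 1 (fun y : R => y^-1) (- x ^- 2).
    have := @is_deriveV R id x 1 1; rewrite gt_eqF// => /(_ isT (is_derive_id _ _)).
    by rewrite /GRing.scale/= mulr1.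
  have := @is_derive1_comp _ g (fun y : R => y^-1) x _ _ dg di.
  move=> dcomp; apply: (@near_eq_is_derive _ _ _ (g \o (fun y : R => y^-1))).
    near=> t; rewrite /flat /g /= ifT//; near: t; exact: lt_nbhsr.
  apply: (is_derive_eq dcomp); rewrite /flat x0.
  case: n {dg g dcomp} => [|n] /=; rewrite ?exprS; field; by rewrite gt_eqF.
- rewrite !flat_le0// mulr0 subr0.
  have E : (fun h : R => h^-1 *: (flat n (h *: 1 + 0) - flat n 0)) @ (0 : R)^' --> (0 : R).
    apply/cvgr0Pnorm_le => e e0; near=> h.
    have h0 : h != 0 by near: h; exact: nbhs_dnbhs_neq.
    rewrite [flat n 0]flat_le0// subr0 addr0 [h *: 1]mulr1 normrZ normfV ler_pdivrMl ?normr_gt0//.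
    apply: le_trans (flat_le_sqr n h) _.
    rewrite -real_normK ?num_real// expr2 mulrCA ler_pM2l ?normr_gt0//.
    have f0 : 0 < (n.+2)`!%:R :> R by rewrite ltr0n fact_gt0.
    rewrite -ler_pdivlMl//.
    near: h; apply: dnbhs0_le; by rewrite mulr_gt0// invr_gt0.
  split; first by apply/cvg_ex; exists 0.
  exact: cvg_lim E.
Unshelve. all: by end_near. Qed.

Lemma continuous_flat n : continuous (flat n).
Proof.
move=> x; apply/differentiable_continuous/derivable1_diffP.
by have [] := is_derive_flat n x.
Qed.

Lemma cvg_flat0 t : 0 < t -> flat 0 (n.+1%:R * t) @[n --> \oo] --> (1 : R).
Proof.
move=> t0.
have -> : (fun n => flat 0 (n.+1%:R * t)) = (fun n => expR (- (harmonic n * t^-1))).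
  by apply/funext => n; rewrite /flat mulr_gt0// expr0 mul1r invfM.
rewrite -[X in _ --> X]expR0.
have h : - (harmonic n * t^-1) @[n --> \oo] --> (0 : R).
  rewrite -oppr0; apply: cvgN; rewrite -(mul0r t^-1).
  by apply: cvgM; [exact: cvg_harmonic|exact: cvg_cst].
exact: (cvg_comp _ _ h (@continuous_expR R 0)).
Qed.

End flat_functions.

(** * Smooth bumps on boxes *)

Section smooth_bumps.
Context {R : realType} {N : nat}.
Local Notation T := 'rV[R]_N.
Local Notation mu := (lebesgue_rV R N).
Implicit Types (f g : T -> R).

(** A class of continuous functions stable under every partial derivative. Smoothness then follows
    by induction on the list of derivatives, with no formula for the iterated ones. *)
Inductive flat_algebra : (T -> R) -> Prop :=
| flat_base n (s c : R) (i : 'I_N) :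
    flat_algebra (fun x => flat n (s * (x ord0 i - c)))
| flat_cst (c : R) : flat_algebra (cst c)
| flat_add f g : flat_algebra f -> flat_algebra g -> flat_algebra (f + g)
| flat_mul f g : flat_algebra f -> flat_algebra g -> flat_algebra (f * g).

Lemma flat_algebra_continuous f : flat_algebra f -> continuous f.
Proof.
elim => {f} [n s c i|c|f g _ cf _ cg|f g _ cf _ cg] x.
- have h : (fun y : T => s * (y ord0 i - c)) @ x --> s * (x ord0 i - c).
    have h0 : (fun y : T => y ord0 i : R) @ x --> x ord0 i by exact: coord_continuous.
    exact: (cvgM (cvg_cst s) (cvgB h0 (cvg_cst c))).
  exact: (cvg_comp _ _ h (@continuous_flat R n _)).
- exact: (@cst_continuous _ _ c).
- exact: (continuousD (cf x) (cg x)).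
- exact: (continuousM (cf x) (cg x)).
Qed.

Lemma is_derive_coord (a : R -> R) (da : R) (i k : 'I_N) (x : T) :
  is_derive (x ord0 i) 1 a da ->
  is_derive x (delta_mx ord0 k) (fun y : T => a (y ord0 i)) ((i == k)%:R * da).
Proof.
move=> [dera deraE].
have E : (fun h : R => h^-1 *: (a ((h *: delta_mx ord0 k + x) ord0 i) - a (x ord0 i))) =
    if i == k then (fun h : R => h^-1 *: (a (h *: 1 + x ord0 i) - a (x ord0 i)))
    else cst 0.
  apply/funext => h; rewrite !mxE eqxx/=.
  case: eqP => _; first by [].
  by rewrite mulr0 add0r subrr scaler0.
have [ik|ik] := eqVneq i k.
  rewrite mul1r; split; first by rewrite /derivable E ik eqxx -ik.
  by rewrite /derive E ik eqxx -ik.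
rewrite mul0r; split.
  by rewrite /derivable E (negbTE ik); exact: is_cvg_cst.
by rewrite /derive E (negbTE ik); exact: lim_cst.
Qed.

Lemma flat_algebra_derive f k : flat_algebra f ->
  (forall x, derivable f x (delta_mx ord0 k)) /\ flat_algebra (pderiv k f).
Proof.
elim => {f} [n s c i|c|f g Ff [df Fdf] Fg [dg Fdg]|f g Ff [df Fdf] Fg [dg Fdg]].
- have h x : is_derive x (delta_mx ord0 k : T) (fun y : T => flat n (s * (y ord0 i - c)))
      ((i == k)%:R * (s * (flat n.+2 (s * (x ord0 i - c)) - n%:R * flat n.+1 (s * (x ord0 i - c))))).
    apply: (is_derive_coord (a := fun t => flat n (s * (t - c)))).
    have h1 := is_derive_flat n (s * (x ord0 i - c)).
    have h2 : is_derive (x ord0 i) 1 (fun t : R => s * (t - c)) s.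
      have e := is_deriveM (is_derive_cst s (x ord0 i) (1 : R))
        (is_deriveB (is_derive_id (x ord0 i) (1 : R)) (is_derive_cst c (x ord0 i) (1 : R))).
      by apply: (is_derive_eq e); rewrite /GRing.scale/= subr0 mulr0 addr0 mulr1.
    have := @is_derive1_comp _ (flat n) (fun t => s * (t - c)) _ _ _ h1 h2.
    by move=> h3; apply: (is_derive_eq h3); rewrite mulrC.
  split=> [x|]; first by have [] := h x.
  have -> : pderiv k (fun y : T => flat n (s * (y ord0 i - c))) =
     cst ((i == k)%:R * s) *
      ((fun x : T => flat n.+2 (s * (x ord0 i - c))) +
       cst (- n%:R) * (fun x : T => flat n.+1 (s * (x ord0 i - c)))).
    apply/funext => x; rewrite /pderiv; have [_ ->] := h x.
    by rewrite !fctE; ring.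
  apply: flat_mul; first exact: flat_cst.
  apply: flat_add; first exact: flat_base.
  by apply: flat_mul; [exact: flat_cst|exact: flat_base].
- split=> [x|]; first exact: derivable_cst.
  have -> : pderiv k (cst c : T -> R) = cst 0.
    by apply/funext => x; rewrite /pderiv derive_cst.
  exact: flat_cst.
- split=> [x|]; first exact: derivableD.
  have -> : pderiv k (f + g) = pderiv k f + pderiv k g.
    by apply/funext => x; rewrite /pderiv deriveD.
  exact: flat_add.
- split=> [x|]; first exact: derivableM.
  have -> : pderiv k (f * g) = f * pderiv k g + g * pderiv k f.
    by apply/funext => x; rewrite /pderiv deriveM.
  by apply: flat_add; exact: flat_mul.
Qed.

Lemma flat_algebra_smooth f : flat_algebra f -> smooth f.
Proof.
move=> Ff s.
have Fs : flat_algebra (foldr (@pderiv R N) f s).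
  by elim: s => //= k s IHs; have [] := flat_algebra_derive k IHs.
split; first exact: flat_algebra_continuous.
by move=> k x; have [] := flat_algebra_derive k Fs.
Qed.

(** Each factor vanishes outside one face of the box, and the scale [n.+1] pushes it to 1 inside.
    The bumps therefore tend to the indicator of the open box without leaving it, so no
    mollification is required. *)
Definition box_bump (a b : T) (n : nat) (x : T) : R := \prod_(i < N)
  (flat 0 (n.+1%:R * (x ord0 i - a ord0 i)) * flat 0 (- n.+1%:R * (x ord0 i - b ord0 i))).

Lemma smooth_box_bump a b n : smooth (box_bump a b n).
Proof.
apply: flat_algebra_smooth.
have -> : box_bump a b n = \prod_(i < N)
   ((fun x : T => flat 0 (n.+1%:R * (x ord0 i - a ord0 i))) *
    (fun x : T => flat 0 (- n.+1%:R * (x ord0 i - b ord0 i)))).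
  by apply/funext => x; rewrite fct_prodE.
elim/big_ind : _ => [|f g Ff Fg|i _]; first exact: flat_cst.
  exact: flat_mul.
by apply: flat_mul; exact: flat_base.
Qed.

Lemma box_bump_ge0 a b n x : 0 <= box_bump a b n x.
Proof. by apply: prodr_ge0 => i _; rewrite mulr_ge0// flat_ge0. Qed.

Lemma box_bump_le1 a b n x : box_bump a b n x <= 1.
Proof.
apply: prodr_ile1 => i _.
by rewrite mulr_ge0 ?flat_ge0//= mulr_ile1// ?flat_ge0 ?flat0_le1.
Qed.

Lemma box_bump_out a b n x : ~ obox a b x -> box_bump a b n x = 0.
Proof.
move=> abx.
have [i xi_out] : exists i, ~ (x ord0 i \in `]a ord0 i, b ord0 i[) by apply/existsNP.
move: xi_out.
rewrite in_itv/= => /negP; rewrite negb_and -!leNgt => /orP xi.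
rewrite /box_bump (bigD1 i)//=.
case: xi => xi; [rewrite [flat 0 (n.+1%:R * _)]flat_le0 ?mul0r//|
                 rewrite [flat 0 (- n.+1%:R * _)]flat_le0 ?mulr0 ?mul0r//].
  by rewrite mulr_ge0_le0// subr_le0.
by rewrite mulr_le0_ge0 ?oppr_le0// subr_ge0.
Qed.

Lemma cvg_box_bump a b x : box_bump a b n x @[n --> \oo] --> (\1_(obox a b) x : R).
Proof.
rewrite indicE; have [abx|abx] := pselect (obox a b x); last first.
  by rewrite memNset//; under eq_fun do rewrite box_bump_out//; exact: cvg_cst.
rewrite mem_set//= /box_bump.
rewrite [X in _ --> X](_ : _ = \prod_(i < N) (1 * 1 : R)); last first.
  by rewrite big1// => i _; rewrite mulr1.
apply: cvg_big => [|i _]; first by move=> y; exact: mul_continuous.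
have := abx i; rewrite in_itv/= => /andP[ax xb].
apply: cvgM; first by apply: cvg_flat0; rewrite subr_gt0.
under eq_fun do rewrite mulNr -mulrN opprB.
by apply: cvg_flat0; rewrite subr_gt0.
Qed.

End smooth_bumps.

Section fundamental_lemma.
Context {R : realType} {N : nat}.
Local Notation T := 'rV[R]_N.
Local Notation mu := (lebesgue_rV R N).
Variables (Omega : set T) (f : T -> R).
Hypothesis oOmega : open Omega.
Hypothesis mf : measurable_fun setT f.
Hypothesis f2 : (sqn f < +oo)%E.
Hypothesis f_orth : forall psi : T -> R, smooth psi ->
  (exists K, [/\ compact K, K `<=` Omega & forall x, ~ K x -> psi x = 0]) ->
  \int[mu]_x (f x * psi x) = 0.

Let integrable_box a b : mu.-integrable setT (fun x => (f x * \1_(obox a b) x)%:E).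
Proof.
apply: integrable_mul => //.
  by apply: measurable_indic; exact: measurable_obox.
rewrite /sqn; under eq_integral => x _.
  rewrite (_ : _ ^+ 2 = \1_(obox a b) x); last first.
    by rewrite indicE; case: (_ \in _); rewrite ?expr1n ?expr0n.
  over.
rewrite integral_indic ?setIT; [exact: obox_lty|by []|exact: measurable_obox].
Qed.

(** The closed box is a compact support allowed in [f_orth]; the bumps tend to the indicator and are
    dominated by it. *)
Lemma integral_box_eq0 a b : cbox a b `<=` Omega ->
  (\int[mu]_x (f x * \1_(obox a b) x)%:E = 0)%E.
Proof.
move=> abO.
have mbump n : measurable_fun setT (box_bump a b n).
  by apply: continuous_measurable_rV; have [] := smooth_box_bump a b n [::].
have b0 n : (\int[mu]_x (f x * box_bump a b n x)%:E = 0)%E.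
  have ib : mu.-integrable setT (fun x => (f x * box_bump a b n x)%:E).
    apply: (le_integrable measurableT _ _ (integrable_box a b)).
      by apply/measurable_EFinP; exact: measurable_funM.
    move=> x _ /=; rewrite lee_fin !normrM ler_wpM2l// indicE.
    have [abx|abx] := pselect (obox a b x).
      by rewrite mem_set//= normr1 ger0_norm ?box_bump_ge0// box_bump_le1.
    by rewrite memNset// box_bump_out.
  have := f_orth (@smooth_box_bump R N a b n).
  rewrite /Rintegral => h; rewrite -[LHS]fineK ?h//; last exact: integrable_fin_num.
  exists (cbox a b); split => //; first exact: compact_cbox.
  by move=> x abx; rewrite box_bump_out// => /obox_cbox.
have [] := @dominated_convergence _ _ _ mu setT measurableT
  (fun n x => (f x * box_bump a b n x)%:E) (fun x => (f x * \1_(obox a b) x)%:E)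
  (fun x => `|(f x * \1_(obox a b) x)%:E|%E).
- by move=> n; apply/measurable_EFinP; exact: measurable_funM.
- exact: measurable_int (integrable_box a b).
- apply: nearW => x _; apply: cvg_EFin; first exact: nearW.
  by apply: cvgM; [exact: cvg_cst|exact: cvg_box_bump].
- exact: integrable_abse.
- apply: nearW => x n _ /=; rewrite lee_fin !normrM ler_wpM2l// indicE.
  have [abx|abx] := pselect (obox a b x).
    by rewrite mem_set//= normr1 ger0_norm ?box_bump_ge0// box_bump_le1.
  by rewrite memNset// box_bump_out.
move=> _ _ /=.
have -> : (fun n => \int[mu]_x (f x * box_bump a b n x)%:E)%E = cst 0%E by exact/funext.
by move=> h; exact: (cvg_unique _ h (cvg_cst _)).
Qed.

(** The integral of f over a sub-box is 0. By Dynkin's argument so is the integral over the trace on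
    the box of any measurable set, and a function with that property vanishes almost everywhere. *)
Lemma ae_eq0_box a b : cbox a b `<=` Omega ->
  {ae mu, forall x, obox a b x -> f x = 0}.
Proof.
move=> abO.
have mO := measurable_obox a b.
pose F (x : T) : \bar R := (f x * \1_(obox a b) x)%:E.
have iF : mu.-integrable setT F by exact: integrable_box.
have iFS S : measurable S -> mu.-integrable S F.
  by move=> mS; exact: integrableS iF.
have key S : measurable S -> (\int[mu]_(x in S) F x = 0)%E.
  rewrite measurable_rVE; move: S.
  apply: (dynkin_induction measurable_rVE setI_obox).
  - exact: integral_box_eq0.
  - move=> _ [[c d] _ <-]/=.
    pose p := \row_i Num.max (a ord0 i) (c ord0 i).
    pose q := \row_i Num.min (b ord0 i) (d ord0 i).
    have pqE : obox c d `&` obox a b = obox p q by rewrite setIC obox_setI.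
    rewrite integral_mkcond -[RHS](@integral_box_eq0 p q).
      apply: eq_integral => x _; rewrite patchE /F.
      rewrite -pqE indicI /= !indicE; case: ifPn => cdx.
        by rewrite mul1r.
      by rewrite mul0r mulr0.
    apply: subset_trans abO => v pqv i; have := pqv i.
    by rewrite !mxE !in_itv/= ge_max le_min => /andP[/andP[-> _] /andP[-> _]].
  - move=> S mS S0.
    have := @integral_setU _ _ _ mu S (~` S) F mS (measurableC mS).
    rewrite setUv S0 add0e => h; rewrite -h; first exact: integral_box_eq0.
      exact: measurable_int iF.
    exact/disj_setPCl.
  - move=> G mG tG G0; rewrite integral_bigcup//.
      by rewrite eseries0// => n _ _; exact: G0.
    by apply: iFS; exact: bigcupT_measurable.
have := @integral_ae_eq _ _ _ mu setT measurableT (cst 0%E) F iF (measurable_cst _).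
case.
  by move=> S _ mS; rewrite key// integral0.
move=> Z [mZ Z0 ZF]; exists Z; split => // x /= xN; apply: ZF => /= h.
apply: xN => abx; have := h Logic.I; rewrite /F indicE mem_set// mulr1.
by case.
Qed.

(** Countably many rational boxes with closure in [Omega] cover it, so the exceptional sets unite to
    a null set. *)
Lemma fundamental_lemma : {ae mu, forall x, Omega x -> f x = 0}.
Proof.
have h n : {ae mu, forall x, cbox (rat_corners n).1 (rat_corners n).2 `<=` Omega ->
    obox (rat_corners n).1 (rat_corners n).2 x -> f x = 0}.
  have [abO|abO] := pselect (cbox (rat_corners n).1 (rat_corners n).2 `<=` (Omega : set T)).
    by apply: filterS (ae_eq0_box abO) => x + _.
  by apply: nearW => x /abO.
have := ae_foralln h; apply: filterS => x hx; rewrite (open_bigcup_obox oOmega).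
by move=> [n nO nx]; exact: hx nx.
Qed.

End fundamental_lemma.

(** * Complex vector fields *)

Section real_components.
Context {R : realType}.
Implicit Types (z : R[i]) (b : bool).

Definition part b z : R := if b then complex.Re z else complex.Im z.

Lemma ReM (z z' : R[i]) :
  complex.Re (z * z') = complex.Re z * complex.Re z' - complex.Im z * complex.Im z'.
Proof. by case: z z' => [a b] [c d]. Qed.

Lemma ImM (z z' : R[i]) :
  complex.Im (z * z') = complex.Re z * complex.Im z' + complex.Im z * complex.Re z'.
Proof. by case: z z' => [a b] [c d]. Qed.

Lemma sqr_normc (z : R[i]) : Normc.normc z ^+ 2 = complex.Re z ^+ 2 + complex.Im z ^+ 2.
Proof. by case: z => [a b] /=; rewrite sqr_sqrtr// addr_ge0// sqr_ge0. Qed.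

Lemma part_sqr_le b z : part b z ^+ 2 <= Normc.normc z ^+ 2.
Proof. by rewrite sqr_normc; case: b; rewrite ?lerDl ?lerDr sqr_ge0. Qed.

Lemma complex_eq (z z' : R[i]) : (forall b, part b z = part b z') -> z = z'.
Proof.
by case: z z' => [x y] [x' y'] h; have /= -> := h true; have /= -> := h false.
Qed.

Variable m : nat.
Implicit Types (v w : 'cV[R[i]]_m).

(** The identification of C^m with R^(2m), under which the real part of the Hermitian product is the
    Euclidean product [ip]. *)
Definition rcomp v (i : 'I_m * bool) : R := part i.2 (v i.1 ord0).

Lemma Re_hdot v w : complex.Re (hdot v w) = ip (rcomp v) (rcomp w).
Proof.
rewrite /hdot raddf_sum /ip.
rewrite (eq_bigr (fun p : 'I_m * bool => (fun i b => rcomp v (i, b) * rcomp w (i, b)) p.1 p.2)); last first.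
  by case.
rewrite -(pair_bigA _ (fun i b => rcomp v (i, b) * rcomp w (i, b)))/=.
apply: eq_bigr => i _; rewrite big_bool /rcomp /= ReM.
by case: (w i ord0) => c d /=; rewrite mulrN opprK.
Qed.

Lemma cvnormE v : cvnorm v = nrm (rcomp v).
Proof. by rewrite /cvnorm Re_hdot. Qed.

Lemma sqr_cvnorm v : cvnorm v ^+ 2 = ip (rcomp v) (rcomp v).
Proof. by rewrite cvnormE sqr_nrm. Qed.

Lemma rcomp_radial_scale {N} (rho : R -> R) (u : 'rV[R]_N -> 'cV[R[i]]_m) x i :
  rcomp (radial_scale rho u x) i = radial rho (rcomp (u x)) i.
Proof.
rewrite /rcomp /radial_scale /radial -cvnormE !mxE.
by case: i => i [] /=; case: (u x i ord0) => c d /=; rewrite mul0r ?subr0 ?addr0.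
Qed.

End real_components.

(** * Real and imaginary parts extended by zero *)

Section real_L2.
Context {R : realType} {N : nat}.
Local Notation T := 'rV[R]_N.
Local Notation mu := (lebesgue_rV R N).
Variable Omega : set T.
Hypothesis oOmega : open Omega.
Implicit Types (f g psi : T -> R[i]).

Let mOmega : measurable Omega := open_measurable_rV oOmega.

(** Extension by zero is forced by the difference quotients: a translated point may leave
    [Omega]. *)
Definition rpart (b : bool) f : T -> R := (fun x => part b (f x)) \_ Omega.

Lemma rpart_in b f x : Omega x -> rpart b f x = part b (f x).
Proof. by move=> Ox; rewrite /rpart patchE mem_set. Qed.

Lemma rpart_out b f x : ~ Omega x -> rpart b f x = 0.
Proof. by move=> Ox; rewrite /rpart patchE memNset. Qed.

Lemma measurable_rpart b f : cmeasurable Omega f -> measurable_fun setT (rpart b f).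
Proof. by move=> [fr fi]; apply/(measurable_restrictT _ mOmega); case: b. Qed.

Lemma measurable_sqnormc f : cmeasurable Omega f ->
  measurable_fun Omega (fun x => (Normc.normc (f x) ^+ 2)%:E).
Proof.
move=> [fr fi]; under eq_fun do rewrite sqr_normc.
by apply/measurable_EFinP; apply: measurable_funD; exact: measurable_funX.
Qed.

Lemma sqn_rpart_le b f : cmeasurable Omega f -> (sqn (rpart b f) <= sqL2norm Omega f)%E.
Proof.
move=> mf; rewrite /sqL2norm integral_mkcond; apply: ge0_le_integral => //.
- by move=> x _; rewrite lee_fin sqr_ge0.
- by apply: measurable_sqn; exact: measurable_rpart.
- by apply/(measurable_restrictT _ mOmega); exact: measurable_sqnormc.
move=> x _; rewrite patchE; case: ifPn => [|/negP] xO.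
  by rewrite rpart_in ?lee_fin ?part_sqr_le//; exact: set_mem.
by rewrite rpart_out ?expr0n// => /mem_set.
Qed.

Lemma L2_rpart b f : L2 Omega f ->
  measurable_fun setT (rpart b f) /\ (sqn (rpart b f) < +oo)%E.
Proof.
move=> [mf f2]; split; first exact: measurable_rpart.
exact: le_lt_trans (sqn_rpart_le b mf) f2.
Qed.

Lemma rpartB b f g : rpart b (fun x => f x - g x) = rpart b f \- rpart b g.
Proof.
apply/funext => x /=; have [Ox|Ox] := pselect (Omega x); last by rewrite !rpart_out// subrr.
by rewrite !rpart_in// /part; case: b; rewrite raddfB.
Qed.

Lemma cmeasurableB f g : cmeasurable Omega f -> cmeasurable Omega g ->
  cmeasurable Omega (fun x => f x - g x).
Proof.
move=> [fr fi] [gr gi]; split.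
  by under eq_fun do rewrite raddfB; exact: measurable_funB.
by under eq_fun do rewrite raddfB; exact: measurable_funB.
Qed.

Lemma smooth_C1c (K : set T) (psi : T -> R) k : smooth psi -> compact K ->
  (forall x, ~ K x -> psi x = 0) -> C1c k psi.
Proof.
move=> spsi cK psiK; split.
- by have [] := spsi [::].
- by have [_] := spsi [::]; exact.
- by have [] := spsi [:: k].
- have [M M0 KM] := compact_sub_cbox cK; exists M => // x xM.
  by apply: psiK => /KM.
Qed.

Lemma Cc_infty_C1c k b psi : Cc_infty Omega psi -> C1c k (fun x => part b (psi x)).
Proof.
move=> [sr si [K [cK KO psiK]]].
by case: b; apply: (smooth_C1c k _ cK) => // x /psiK ->.
Qed.

Lemma Cc_infty_rpart b psi : Cc_infty Omega psi ->
  rpart b psi = fun x => part b (psi x).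
Proof.
move=> [_ _ [K [_ KO psiK]]]; apply/funext => x.
have [Ox|Ox] := pselect (Omega x); first by rewrite rpart_in.
by rewrite rpart_out// psiK; [case: b|move=> /KO].
Qed.

(** Extension by zero commutes with differentiation for test functions, because the support is a
    closed set inside [Omega]. For a general H^1 function this fails. *)
Lemma Cc_infty_cpderiv k b psi : Cc_infty Omega psi ->
  rpart b (cpderiv k psi) = pderiv k (fun x => part b (psi x)).
Proof.
move=> [_ _ [K [cK KO psiK]]]; apply/funext => x.
have [Ox|Ox] := pselect (Omega x); first by rewrite rpart_in//; case: b.
rewrite rpart_out// (@pderiv_outside _ _ _ _ K)//.
- by apply: compact_closed => //; exact: norm_hausdorff.
- by move=> y /psiK ->; case: b.
- by move=> /KO.
Qed.

Lemma cmeasurable_Cc psi : Cc_infty Omega psi -> cmeasurable Omega psi.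
Proof.
move=> [sr si _]; split; apply: measurable_funTS; apply: continuous_measurable_rV.
  by have [] := sr [::].
by have [] := si [::].
Qed.

Lemma cmeasurable_cpderiv k psi : Cc_infty Omega psi -> cmeasurable Omega (cpderiv k psi).
Proof.
move=> [sr si _]; split; apply: measurable_funTS; apply: continuous_measurable_rV.
  by have [] := sr [:: k].
by have [] := si [:: k].
Qed.

(** Approximation by test functions in the H^1 norm is used here: it carries over to the zero
    extensions, and [sqn_cvg_dquot] applies on the whole space. *)
Lemma H10_cvg_dquot k b f (df : 'I_N -> T -> R[i]) : H10_grad Omega f df ->
  sqn (dquot k (dyadic n) (rpart b f) \- rpart b (df k)) @[n --> \oo] --> 0%E.
Proof.
move=> [[Lf Ldf] [psi [cpsi psicvg]]].
have [mf f2] := L2_rpart b Lf.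
have [mdf df2] := L2_rpart b (Ldf k).1.
have sqL2_ge0 g : (0 <= sqL2norm Omega g)%E.
  by apply: integral_ge0 => x _; rewrite lee_fin sqr_ge0.
apply: (sqn_cvg_dquot mf mdf (psi := fun j x => part b (psi j x))).
- by move=> j; exact: Cc_infty_C1c.
- apply: (squeeze_cvge _ (cvg_cst 0%E) psicvg); apply: nearW => j.
  rewrite sqn_ge0/= -(Cc_infty_rpart b (cpsi j)) -rpartB.
  apply: le_trans (sqn_rpart_le b (cmeasurableB (cmeasurable_Cc (cpsi j)) Lf.1)) _.
  by rewrite /sqH1norm leeDl// sume_ge0.
- apply: (squeeze_cvge _ (cvg_cst 0%E) psicvg); apply: nearW => j.
  rewrite sqn_ge0/= -(Cc_infty_cpderiv k b (cpsi j)) -rpartB.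
  apply: le_trans (sqn_rpart_le b (cmeasurableB (cmeasurable_cpderiv k (cpsi j)) (Ldf k).1.1)) _.
  rewrite /sqH1norm (bigD1 k)//= addeCA leeDl// adde_ge0// sume_ge0//.
Qed.

End real_L2.

(** * Weak derivatives from real components, and their uniqueness *)

Section weak_derivatives.
Context {R : realType} {N : nat}.
Local Notation T := 'rV[R]_N.
Local Notation mu := (lebesgue_rV R N).
Variable Omega : set T.
Hypothesis oOmega : open Omega.
Implicit Types (f g psi : T -> R[i]) (a c : bool -> T -> R).

Let mOmega : measurable Omega := open_measurable_rV oOmega.

Lemma L2_of_parts f a : (forall b x, Omega x -> part b (f x) = a b x) ->
  (forall b, measurable_fun setT (a b)) -> (forall b, (sqn (a b) < +oo)%E) ->
  L2 Omega f.
Proof.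
move=> fa ma a2.
have mf : cmeasurable Omega f.
  split.
    apply: (@eq_measurable_fun _ _ _ _ _ (a true)); last exact: measurable_funTS.
    by move=> x; rewrite inE => Ox; rewrite -(fa true x Ox).
  apply: (@eq_measurable_fun _ _ _ _ _ (a false)); last exact: measurable_funTS.
  by move=> x; rewrite inE => Ox; rewrite -(fa false x Ox).
split=> //.
apply: (@le_lt_trans _ _ (sqn (a true) + sqn (a false))%E); last first.
  by rewrite lte_add_pinfty.
rewrite /sqL2norm integral_mkcond -ge0_integralD//; first last.
- exact: measurable_sqn.
- by move=> x _; rewrite lee_fin sqr_ge0.
- exact: measurable_sqn.
- by move=> x _; rewrite lee_fin sqr_ge0.
apply: ge0_le_integral => //.
- by move=> x _; apply: erestrict_ge0 => y _; rewrite lee_fin sqr_ge0.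
- by apply/(measurable_restrictT _ mOmega); exact: measurable_sqnormc.
- by apply: emeasurable_funD; exact: measurable_sqn.
move=> x _; rewrite patchE; case: ifPn => [/set_mem Ox|_].
  by rewrite -EFinD lee_fin sqr_normc -(fa true x Ox) -(fa false x Ox).
by rewrite adde_ge0// lee_fin sqr_ge0.
Qed.

(** The pairing with a complex test function involves no conjugate, so its real and imaginary parts
    are combinations of the real pairings of parts of f with parts of psi, each of which is
    integrated by parts. *)
Lemma weak_pderiv_of_parts k f g a c :
  (forall b x, Omega x -> part b (f x) = a b x) ->
  (forall b x, Omega x -> part b (g x) = c b x) ->
  (forall b, measurable_fun setT (a b)) -> (forall b, (sqn (a b) < +oo)%E) ->
  (forall b, measurable_fun setT (c b)) -> (forall b, (sqn (c b) < +oo)%E) ->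
  (forall b (psi : T -> R), C1c k psi ->
     \int[mu]_x (a b x * pderiv k psi x) = - \int[mu]_x (c b x * psi x)) ->
  weak_pderiv Omega k f g.
Proof.
move=> fa gc ma a2 mc c2 ac psi cpsi.
pose p b x := part b (psi x).
have cp b : C1c k (p b) by exact: (Cc_infty_C1c k b cpsi).
have mp b := C1c_measurable (cp b).
have p2 b := C1c_sqn_lty (cp b).
have mdp b := C1c_measurable_pderiv (cp b).
have dp2 b : (sqn (pderiv k (p b)) < +oo)%E by exact: C1c_sqn_pderiv_lty.
have p_out b x : ~ Omega x -> p b x = 0.
  by move=> Ox; rewrite -[p b x](congr1 (@^~ x) (Cc_infty_rpart b cpsi)) rpart_out.
have dp_in b x : Omega x -> part b (cpderiv k psi x) = pderiv k (p b) x.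
  by move=> Ox; rewrite -(Cc_infty_cpderiv k b cpsi) rpart_in.
have dp_out b x : ~ Omega x -> pderiv k (p b) x = 0.
  by move=> Ox; rewrite -(Cc_infty_cpderiv k b cpsi) rpart_out.
have restr (F G : T -> R) : (forall x, Omega x -> F x = G x) ->
    (forall x, ~ Omega x -> G x = 0) -> \int[mu]_(x in Omega) F x = \int[mu]_x G x.
  move=> FG G0; rewrite Rintegral_mkcond; apply: eq_Rintegral => x _.
  rewrite patchE; case: ifPn => [/set_mem/FG//|/negP xO].
  by rewrite G0// => /mem_set.
rewrite /cintegral.
have -> : \int[mu]_(x in Omega) complex.Re (f x * cpderiv k psi x) =
    \int[mu]_x (a true x * pderiv k (p true) x - a false x * pderiv k (p false) x).
  apply: restr => x Ox; last by rewrite !dp_out// !mulr0 subrr.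
  by rewrite ReM -(dp_in true)// -(dp_in false)// -(fa true)// -(fa false).
have -> : \int[mu]_(x in Omega) complex.Im (f x * cpderiv k psi x) =
    \int[mu]_x (a true x * pderiv k (p false) x + a false x * pderiv k (p true) x).
  apply: restr => x Ox; last by rewrite !dp_out// !mulr0 addr0.
  by rewrite ImM -(dp_in true)// -(dp_in false)// -(fa true)// -(fa false).
have -> : \int[mu]_(x in Omega) complex.Re (g x * psi x) =
    \int[mu]_x (c true x * p true x - c false x * p false x).
  apply: restr => x Ox; last by rewrite !p_out// !mulr0 subrr.
  by rewrite ReM -(gc true)// -(gc false).
have -> : \int[mu]_(x in Omega) complex.Im (g x * psi x) =
    \int[mu]_x (c true x * p false x + c false x * p true x).
  apply: restr => x Ox; last by rewrite !p_out// !mulr0 addr0.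
  by rewrite ImM -(gc true)// -(gc false).
have iap b b' : mu.-integrable setT (EFin \o (fun x => a b x * pderiv k (p b') x)).
  exact: integrable_mul.
have icp b b' : mu.-integrable setT (EFin \o (fun x => c b x * p b' x)).
  exact: integrable_mul.
rewrite !RintegralB// !RintegralD// !ac//.
by apply: complex_eq => -[] /=; ring.
Qed.

(** Against a real test function, the real and imaginary parts of g - g' are separately orthogonal,
    and the fundamental lemma applies to each. *)
Lemma weak_pderiv_unique k f g g' : L2 Omega g -> L2 Omega g' ->
  weak_pderiv Omega k f g -> weak_pderiv Omega k f g' ->
  {ae mu, forall x, Omega x -> g x = g' x}.
Proof.
move=> Lg Lg' wg wg'.
have key b : {ae mu, forall x, Omega x -> (rpart Omega b g \- rpart Omega b g') x = 0}.
  have [mg g2] := L2_rpart oOmega b Lg.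
  have [mg' g'2] := L2_rpart oOmega b Lg'.
  apply: fundamental_lemma => //.
  - exact: measurable_funB.
  - have := integrableD measurableT (integrable_sqr mg g2) (integrable_sqr mg' g'2).
    move=> /(integrableZl measurableT 2) iH.
    apply: (sqn_lty_le _ _ iH); first exact: measurable_funB.
    move=> x; rewrite -EFinD -EFinM lee_fin /=.
    by have := sqr_ge0 (rpart Omega b g x + rpart Omega b g' x); lra.
  move=> psi spsi [K [cK KO psiK]].
  have cpsi : Cc_infty Omega (fun x => (psi x)%:C%C).
    split => //=; first exact: flat_algebra_smooth (flat_cst _).
    by exists K; split => // x /psiK ->.
  have /(congr1 (part b)) := etrans (esym (wg _ cpsi)) (wg' _ cpsi).
  have E h : part b (- cintegral Omega (fun x => h x * (psi x)%:C%C)) =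
      - \int[mu]_x (rpart Omega b h x * psi x).
    transitivity (- \int[mu]_(x in Omega) part b (h x * (psi x)%:C%C)).
      by case: (b).
    congr (- _); rewrite Rintegral_mkcond; apply: eq_Rintegral => x _.
    rewrite patchE; case: ifPn => [/set_mem Ox|/negP xO].
      rewrite rpart_in// /part; case: (b); rewrite ?ReM ?ImM /= mulr0.
        by rewrite subr0.
      by rewrite add0r.
    by rewrite rpart_out ?mul0r// => /mem_set.
  rewrite !E => /oppr_inj h.
  have cp : C1c k psi by exact: smooth_C1c cK psiK.
  have mp := C1c_measurable cp.
  have p2 := C1c_sqn_lty cp.
  rewrite (_ : (fun x => _) =
     fun x => rpart Omega b g x * psi x - rpart Omega b g' x * psi x); last first.
    by apply/funext => x /=; rewrite mulrBl.
  by rewrite RintegralB// ?h ?subrr//; exact: integrable_mul.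
have := key true; have := key false; apply: filterS2 => x hi hr Ox.
apply: complex_eq => b; apply/eqP; rewrite -subr_eq0 -!(rpart_in _ _ Ox); apply/eqP.
by case: b; [exact: hr|exact: hi].
Qed.

End weak_derivatives.

(** * Integrability of the bilinear expressions *)

Section complex_integrability.
Context {R : realType} {N : nat}.
Local Notation T := 'rV[R]_N.
Local Notation mu := (lebesgue_rV R N).
Variable Omega : set T.
Hypothesis oOmega : open Omega.
Implicit Types (f g : T -> R[i]).

Let mOmega : measurable Omega := open_measurable_rV oOmega.

Definition cintegrable f : Prop :=
  forall b, mu.-integrable Omega (fun x => (part b (f x))%:E).

Lemma cintegrable_sum (J : finType) (F : J -> T -> R[i]) :
  (forall j, cintegrable (F j)) -> cintegrable (fun x => \sum_j F j x).
Proof.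
move=> iF b.
rewrite (_ : (fun x => _) = fun x => (\sum_j (part b (F j x))%:E)%E); last first.
  by apply/funext => x; rewrite sumEFin; case: b; rewrite /= raddf_sum.
by apply: integrable_sum => // j _; exact: iF.
Qed.

Lemma integrable_mul_parts b b' f g : L2 Omega f -> L2 Omega g ->
  mu.-integrable Omega (fun x => (part b (f x) * part b' (g x))%:E).
Proof.
move=> Lf Lg; have [mf f2] := L2_rpart oOmega b Lf; have [mg g2] := L2_rpart oOmega b' Lg.
have := integrableS measurableT mOmega (@subsetT _ Omega) (integrable_mul mf mg f2 g2).
by apply: eq_integrable => // x /set_mem Ox; rewrite !rpart_in.
Qed.

Lemma cintegrable_mul_conj f g : L2 Omega f -> L2 Omega g ->
  cintegrable (fun x => f x * conjc (g x)).
Proof.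
move=> Lf Lg [].
  have := integrableD mOmega (integrable_mul_parts true true Lf Lg)
    (integrable_mul_parts false false Lf Lg).
  apply: eq_integrable => // x _; rewrite /= -EFinD ReM; congr EFin.
  by case: (g x) => c d /=; rewrite mulrN opprK.
have := integrableB mOmega (integrable_mul_parts false true Lf Lg)
  (integrable_mul_parts true false Lf Lg).
apply: eq_integrable => // x _; rewrite /= -EFinB ImM; congr EFin.
by case: (g x) => c d /=; rewrite mulrN addrC.
Qed.

Lemma integrable_mul_bounded (a h : T -> R) (M : R) : measurable_fun Omega a ->
  {ae mu, forall x, Omega x -> `|a x| <= M} ->
  mu.-integrable Omega (EFin \o h) ->
  mu.-integrable Omega (fun x => (a x * h x)%:E).
Proof.
move=> ma aM ih; have mh : measurable_fun Omega h.
  by apply/measurable_EFinP; exact: measurable_int ih.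
have mah : measurable_fun Omega (fun x => (a x * h x)%:E).
  by apply/measurable_EFinP; exact: measurable_funM.
have iMh : mu.-integrable Omega (fun x => (`|M|%:E * (h x)%:E)%E).
  exact: (integrableZl mOmega `|M| ih).
apply/integrableP; split => //.
have /integrableP[_] := iMh; apply: le_lt_trans.
apply: ae_ge0_le_integral => //.
- exact: measurableT_comp.
- by apply: measurableT_comp => //; case/integrableP : iMh.
apply: filterS aM => x aM Ox; rewrite -EFinM !abse_EFin lee_fin !normrM normr_id.
by rewrite ler_wpM2r// (le_trans (aM Ox))// ler_norm.
Qed.

Lemma cintegrable_mul_bounded f g : Linfty Omega f -> cintegrable g ->
  cintegrable (fun x => f x * g x).
Proof.
move=> [[fr fi] [M fM]] ig.
have h b b' : mu.-integrable Omega (fun x => (part b (f x) * part b' (g x))%:E).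
  apply: (@integrable_mul_bounded (fun x => part b (f x)) (fun x => part b' (g x)) M).
  - by case: b.
  - apply: filterS fM => x fM Ox; apply: le_trans (fM Ox).
    rewrite -(@ler_pXn2r _ 2)// ?nnegrE//; last by case: (f x) => ? ?; exact: sqrtr_ge0.
    by rewrite real_normK ?num_real// part_sqr_le.
  - exact: ig.
case.
  have := integrableB mOmega (h true true) (h false false).
  by apply: eq_integrable => // x _; rewrite /= -EFinB ReM.
have := integrableD mOmega (h true false) (h false true).
by apply: eq_integrable => // x _; rewrite /= -EFinD ImM.
Qed.

(** The inequality is made to hold everywhere by replacing g with max(f, g), which equals g almost
    everywhere. *)
Lemma ae_le_Rintegral (f g : T -> R) :
  mu.-integrable Omega (EFin \o f) -> mu.-integrable Omega (EFin \o g) ->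
  {ae mu, forall x, Omega x -> f x <= g x} ->
  \int[mu]_(x in Omega) f x <= \int[mu]_(x in Omega) g x.
Proof.
move=> iF iG fg.
have mF : measurable_fun Omega f by apply/measurable_EFinP; exact: measurable_int iF.
have mG : measurable_fun Omega g by apply/measurable_EFinP; exact: measurable_int iG.
have iM : mu.-integrable Omega (EFin \o (fun x => Num.max (f x) (g x))).
  have := integrableD mOmega (integrable_abse iF) (integrable_abse iG).
  apply: le_integrable => //.
    by apply/measurable_EFinP; exact: measurable_maxr.
  move=> x _ /=; rewrite lee_fin maxEle; case: ifP => _.
    by rewrite ler_normr lerDr normr_ge0.
  by rewrite ler_normr lerDl normr_ge0.
have -> : \int[mu]_(x in Omega) g x = \int[mu]_(x in Omega) Num.max (f x) (g x).
  rewrite /Rintegral; congr fine; apply: ae_eq_integral => //.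
  - exact/measurable_EFinP.
  - by apply/measurable_EFinP; exact: measurable_maxr.
  by apply: filterS fg => x fg Ox; rewrite max_r// fg.
by apply: le_Rintegral => // x _; rewrite le_max lexx.
Qed.

End complex_integrability.

(** * Dissipativity *)

Section dissipativity.
Context {R : realType} {N m : nat}.
Local Notation T := 'rV[R]_N.
Local Notation mu := (lebesgue_rV R N).
Variable Omega : set T.
Hypothesis oOmega : open Omega.
Let mOmega : measurable Omega := open_measurable_rV oOmega.
Implicit Types (u : T -> 'cV[R[i]]_m) (du dw dz : 'I_N -> T -> 'cV[R[i]]_m).

Definition vL2 (v : T -> 'cV[R[i]]_m) : Prop := forall i, L2 Omega (fun x => v x i ord0).

Definition grad_pairing du dw (x : T) : R :=
  \sum_(k < N) complex.Re (hdot (du k x) (dw k x)).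

Lemma cintegrable_hdot (v w : T -> 'cV[R[i]]_m) (B : T -> 'M[R[i]]_m) :
  (forall i j, Linfty Omega (fun x => B x i j)) -> vL2 v -> vL2 w ->
  cintegrable Omega (fun x => hdot (B x *m v x) (w x)).
Proof.
move=> LB Lv Lw.
rewrite (_ : (fun x => _) = fun x =>
   \sum_(i < m) \sum_(j < m) B x i j * (v x j ord0 * conjc (w x i ord0))); last first.
  apply/funext => x; rewrite /hdot; apply: eq_bigr => i _.
  by rewrite mxE mulr_suml; apply: eq_bigr => j _; rewrite mulrA.
apply: (cintegrable_sum oOmega) => i; apply: (cintegrable_sum oOmega) => j.
apply: (cintegrable_mul_bounded oOmega); first exact: LB.
by apply: (cintegrable_mul_conj oOmega); [exact: Lv|exact: Lw].
Qed.

Lemma integrable_Re_hdot (v w : T -> 'cV[R[i]]_m) : vL2 v -> vL2 w ->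
  mu.-integrable Omega (EFin \o (fun x => complex.Re (hdot (v x) (w x)))).
Proof.
move=> Lv Lw.
have h : cintegrable Omega (fun x => hdot (v x) (w x)).
  apply: (cintegrable_sum oOmega) => i.
  by apply: (cintegrable_mul_conj oOmega); [exact: Lv|exact: Lw].
exact: h true.
Qed.

Lemma integrable_grad_pairing du dw : (forall k, vL2 (du k)) -> (forall k, vL2 (dw k)) ->
  mu.-integrable Omega (EFin \o grad_pairing du dw).
Proof.
move=> Ldu Ldw.
rewrite (_ : EFin \o _ =
  fun x => (\sum_(k < N) (complex.Re (hdot (du k x) (dw k x)))%:E)%E); last first.
  by apply/funext => x; rewrite sumEFin.
by apply: integrable_sum => // k _; exact: integrable_Re_hdot.
Qed.

(** The real-valued integral is additive only on integrable functions; the L^infinity bound on the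
    coefficients and the L^2 bounds on the gradients provide this. *)
Lemma diss_form_sub_laplacian (A : 'I_N -> 'I_N -> T -> 'M[R[i]]_m) kappa du dw :
  (forall h k i j, Linfty Omega (fun x => A h k x i j)) ->
  (forall k, vL2 (du k)) -> (forall k, vL2 (dw k)) ->
  diss_form Omega (sub_laplacian A kappa) du dw =
  diss_form Omega A du dw - kappa * \int[mu]_(x in Omega) grad_pairing du dw x.
Proof.
move=> LA Ldu Ldw; rewrite /diss_form /cintegral /=.
have iQ := integrable_grad_pairing Ldu Ldw.
have iA : mu.-integrable Omega (EFin \o (fun x => complex.Re
    (\sum_(h < N) \sum_(k < N) hdot (A h k x *m du k x) (dw h x)))).
  suff h : cintegrable Omega (fun x =>
      \sum_(h < N) \sum_(k < N) hdot (A h k x *m du k x) (dw h x)) by exact: h true.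
  apply: (cintegrable_sum oOmega) => h; apply: (cintegrable_sum oOmega) => k.
  exact: cintegrable_hdot.
rewrite -RintegralZl// -RintegralB//; last exact: (integrableZl mOmega kappa iQ).
have Re_sum2 (F : 'I_N -> 'I_N -> R[i]) : complex.Re (\sum_(h < N) \sum_(k < N) F h k) =
    \sum_(h < N) \sum_(k < N) complex.Re (F h k).
  by rewrite raddf_sum; apply: eq_bigr => h _; rewrite raddf_sum.
apply: eq_Rintegral => x _; rewrite /grad_pairing !Re_sum2 mulr_sumr -sumrB.
apply: eq_bigr => h _.
(* Only the diagonal coefficients, h = k, are altered by the Laplacian. *)
rewrite [in RHS](bigD1 h)//= [in LHS](bigD1 h)//= addrAC.
have E (B : 'M[R[i]]_m) (c : R) (v w : 'cV[R[i]]_m) :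
    complex.Re (hdot ((B - (c%:C%C)%:M) *m v) w) =
    complex.Re (hdot (B *m v) w) - c * complex.Re (hdot v w).
  rewrite /hdot !raddf_sum mulr_sumr -sumrB; apply: eq_bigr => i _ /=.
  rewrite mulmxBl mul_scalar_mx !mxE mulrBl raddfB; congr (_ - _).
  by rewrite /= -mulrA ReM /= mul0r subr0.
rewrite /sub_laplacian; congr (_ + _); first by rewrite E eqxx mulr1.
by apply: eq_bigr => k kh; rewrite E eq_sym (negbTE kh) mulr0 mul0r subr0.
Qed.

Variables (phi : R -> R) (delta : R).
Hypothesis phi0 : forall s : R, 0 < s -> 0 < phi s.
Hypothesis phi' : forall s : R, 0 < s -> derivable phi s 1.
Hypothesis delta01 : 0 < delta <= 1.
Hypothesis elliptic : forall s : R, 0 < s ->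
  delta * (2 * phi s + s * derive1 phi s) ^+ 2 <= 4 * phi s * (phi s + s * derive1 phi s).

Lemma vH10_L2 u du k : vH10_grad Omega u du -> vL2 (du k).
Proof. by move=> h i; have [[_ /(_ k)[]]] := h i. Qed.

Lemma vH1_L2 u du k : vH1_grad Omega u du -> vL2 (du k).
Proof. by move=> h i; have [_ /(_ k)[]] := h i. Qed.

(** Each direction [k] is treated on its own, over the real components indexed by ['I_m * bool]. The
    real limits are reassembled into complex vectors, and the pointwise bounds are summed over
    [k]. *)
Lemma vH10_radial_sqrt u du dw : vH10_grad Omega u du ->
  vH10_grad Omega (radial_scale phi u) dw ->
  exists2 dz, vH1_grad Omega (radial_scale (fun s => Num.sqrt (phi s)) u) dz &
    {ae mu, forall x, Omega x ->
      delta * grad_pairing dz dz x <= grad_pairing du dw x <= grad_pairing dz dz x}.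
Proof.
move=> Hu Hw.
pose ext (v : T -> 'cV[R[i]]_m) (i : 'I_m * bool) := rpart Omega i.2 (fun x => v x i.1 ord0).
have ext_in v i x : Omega x -> ext v i x = rcomp (v x) i.
  by move=> Ox; rewrite /ext rpart_in.
have extL2 v (Lv : vL2 v) i : measurable_fun setT (ext v i) /\ (sqn (ext v i) < +oo)%E.
  exact: (L2_rpart oOmega i.2 (Lv i.1)).
have Lu : vL2 u by move=> i; have [[]] := Hu i.
have Lw : vL2 (radial_scale phi u) by move=> i; have [[]] := Hw i.
have Ldu k : vL2 (du k) := vH10_L2 k Hu.
have Ldw k : vL2 (dw k) := vH10_L2 k Hw.
have wE i x : ext (radial_scale phi u) i x = radial phi (fun j => ext u j x) i.
  have [Ox|Ox] := pselect (Omega x); last by rewrite /radial /ext !rpart_out// mulr0.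
  rewrite ext_in// rcomp_radial_scale; congr (radial phi _ i).
  by apply/funext => j; rewrite ext_in.
have /choice[g gP] k := radial_chain_rule (k := k) phi0 phi' delta01 elliptic wE
  (fun i => (extL2 _ Lu i).1) (fun i => (extL2 _ Lw i).1)
  (fun i => (extL2 _ (Ldu k) i).1) (fun i => (extL2 _ (Ldw k) i).1)
  (fun i => (extL2 _ Lu i).2) (fun i => (extL2 _ Lw i).2)
  (fun i => (extL2 _ (Ldu k) i).2) (fun i => (extL2 _ (Ldw k) i).2)
  (fun i => H10_cvg_dquot oOmega k i.2 (Hu i.1))
  (fun i => H10_cvg_dquot oOmega k i.2 (Hw i.1)).
pose dz k x : 'cV[R[i]]_m := \col_i (g k (i, true) x +i* g k (i, false) x)%C.
have dzE k x : rcomp (dz k x) = (g k)^~ x.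
  by apply/funext => -[i []]; rewrite /rcomp /dz mxE.
pose V := radial_comp phi (ext u).
have mV i : measurable_fun setT (V i).
  exact: (measurable_radial_comp phi' (fun i => (extL2 _ Lu i).1)).
have V2 i : (sqn (V i) < +oo)%E.
  exact: (sqn_radial_comp phi0 phi' wE (fun i => (extL2 _ Lu i).1)
    (fun i => (extL2 _ Lw i).1) (fun i => (extL2 _ Lu i).2) (fun i => (extL2 _ Lw i).2)).
have VE i b x : Omega x ->
    part b (radial_scale (fun s => Num.sqrt (phi s)) u x i ord0) = V (i, b) x.
  move=> Ox; transitivity (rcomp (radial_scale (fun s => Num.sqrt (phi s)) u x) (i, b)).
    by [].
  rewrite rcomp_radial_scale /V /radial_comp; congr (radial _ _ _).
  by apply/funext => j; rewrite ext_in.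
have gE i b k x : part b (dz k x i ord0) = g k (i, b) x.
  by rewrite /dz mxE; case: b.
exists dz.
  move=> i; split.
    by apply: (L2_of_parts oOmega (a := fun b => V (i, b))) => // b x; exact: VE.
  move=> k; have [mg g2 _ wg] := gP k; split.
    by apply: (L2_of_parts oOmega (a := fun b => g k (i, b))) => // b x _; exact: gE.
  exact: (@weak_pderiv_of_parts R N Omega k _ _ (fun b => V (i, b))
    (fun b => g k (i, b)) (VE i) (fun b x _ => gE i b k x) (fun b => mV (i, b))
    (fun b => V2 (i, b)) (fun b => mg (i, b)) (fun b => g2 (i, b)) (fun b => wg (i, b))).
have : {ae mu, forall x k, delta * ip ((g k)^~ x) ((g k)^~ x) <=
   ip (fun i => ext (du k) i x) (fun i => ext (dw k) i x) <= ip ((g k)^~ x) ((g k)^~ x)}.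
  by apply: filter_forall => k; have [] := gP k.
apply: filterS => x h Ox; rewrite /grad_pairing.
have E k : complex.Re (hdot (du k x) (dw k x)) =
    ip (fun i => ext (du k) i x) (fun i => ext (dw k) i x).
  by rewrite Re_hdot; congr ip; apply/funext => i; rewrite ext_in.
apply/andP; split.
  rewrite mulr_sumr; apply: ler_sum => k _; rewrite E Re_hdot dzE.
  by have /andP[] := h k.
apply: ler_sum => k _; rewrite E Re_hdot dzE.
by have /andP[] := h k.
Qed.

Lemma vH1_grad_unique v dz dz' : vH1_grad Omega v dz -> vH1_grad Omega v dz' ->
  {ae mu, forall x, Omega x -> forall k, dz k x = dz' k x}.
Proof.
move=> Hz Hz'.
have : {ae mu, forall x k, forall i, Omega x -> dz k x i ord0 = dz' k x i ord0}.
  apply: filter_forall => k; apply: filter_forall => i.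
  have [_ /(_ k)[L w]] := Hz i; have [_ /(_ k)[L' w']] := Hz' i.
  exact: (weak_pderiv_unique oOmega L L' w w').
by apply: filterS => x h Ox k; apply/colP => i; exact: h.
Qed.

(** This turns the extended-real integral in the definition of strictness into a finite real one, so
    that both forms can be compared in the reals. *)
Lemma integral_grad_pairing_self dz : (forall k, vL2 (dz k)) ->
  (\int[mu]_(x in Omega) (\sum_(k < N) cvnorm (dz k x) ^+ 2)%:E =
   (\int[mu]_(x in Omega) grad_pairing dz dz x)%:E)%E.
Proof.
move=> Lz; rewrite /Rintegral fineK; last first.
  exact: integrable_fin_num (integrable_grad_pairing Lz Lz).
apply: eq_integral => x _; congr EFin; apply: eq_bigr => k _.
by rewrite sqr_cvnorm Re_hdot.
Qed.

Lemma strict_LPhi_dissipativeP (A : 'I_N -> 'I_N -> T -> 'M[R[i]]_m) :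
  (forall h k i j, Linfty Omega (fun x => A h k x i j)) ->
  strict_LPhi_dissipative Omega A phi <->
  exists2 kappa : R, 0 < kappa & LPhi_dissipative Omega (sub_laplacian A kappa) phi.
Proof.
move=> LA; split=> -[kappa kappa0 H].
  exists kappa => // u du dw Hu Hw.
  have Ldu k : vL2 (du k) := vH10_L2 k Hu.
  have Ldw k : vL2 (dw k) := vH10_L2 k Hw.
  have [dz Hz] := H u du dw Hu Hw.
  have Lz k : vL2 (dz k) := vH1_L2 k Hz.
  rewrite (integral_grad_pairing_self Lz) -EFinM lee_fin => le_form.
  rewrite diss_form_sub_laplacian// subr_ge0; apply: le_trans le_form.
  rewrite ler_pM2l//; have [dz' Hz' ineq] := vH10_radial_sqrt Hu Hw.
  apply: (ae_le_Rintegral oOmega); [exact: integrable_grad_pairing..|].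
  have uniq := vH1_grad_unique Hz Hz'.
  apply: filterS2 ineq uniq => x + zz Ox => /(_ Ox)/andP[_ /le_trans]; apply.
  by rewrite /grad_pairing; apply: ler_sum => k _; rewrite zz.
have [d0 d1] := andP delta01.
(* The lower bound delta |DV|^2 <= Re <Du, DW> costs the factor delta; the other direction keeps
   [kappa]. *)
exists (kappa * delta); first exact: mulr_gt0.
move=> u du dw Hu Hw.
have Ldu k : vL2 (du k) := vH10_L2 k Hu.
have Ldw k : vL2 (dw k) := vH10_L2 k Hw.
have [dz Hz ineq] := vH10_radial_sqrt Hu Hw; exists dz => //.
have Lz k : vL2 (dz k) := vH1_L2 k Hz.
rewrite (integral_grad_pairing_self Lz) -EFinM lee_fin.
have := H u du dw Hu Hw; rewrite diss_form_sub_laplacian// subr_ge0.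
apply: le_trans; rewrite -mulrA ler_pM2l//.
have iz := integrable_grad_pairing Lz Lz.
rewrite -RintegralZl//.
apply: (ae_le_Rintegral oOmega).
- exact: (integrableZl mOmega delta iz).
- exact: integrable_grad_pairing.
- by apply: filterS ineq => x + Ox => /(_ Ox)/andP[].
Qed.

End dissipativity.

(** At the point s sqrt(phi s) one has 1 - Lambda^2 = 4 phi (phi + s phi') / (2 phi + s phi')^2, so
    delta = 1 - sup Lambda^2 works. It is positive by assumption, and at most 1 because the supremum
    of squares over a nonempty set is nonnegative. *)
Lemma Lambda_ellipticity (R : realType) (phi Lambda : R -> R) :
  phi_conditions phi -> is_Lambda phi Lambda ->
  (ereal_sup [set (Lambda t ^+ 2)%:E | t in [set t : R | (0 < t)%R]] < 1)%E ->
  exists2 delta : R, 0 < delta <= 1 & forall s : R, 0 < s ->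
    delta * (2 * phi s + s * derive1 phi s) ^+ 2 <=
    4 * phi s * (phi s + s * derive1 phi s).
Proof.
move=> phiP LP; set S := ereal_sup _ => S1.
have ub t : 0 < t -> ((Lambda t ^+ 2)%:E <= S)%E.
  by move=> t0; apply: ereal_sup_ubound; exists t.
have S0 : (0 <= S)%E by apply: le_trans (ub 1 ltr01); rewrite lee_fin sqr_ge0.
have Sfin : S \is a fin_num by rewrite ge0_fin_numE// (lt_trans S1)// ltry.
exists (1 - fine S).
  rewrite subr_gt0 -lte_fin fineK// S1 /= lerBlDr lerDl.
  by rewrite -lee_fin fineK.
move=> s s0; have ps := phi_gt0 phiP s0.
have t0 : 0 < s * Num.sqrt (phi s) by rewrite mulr_gt0// sqrtr_gt0.
have := ub _ t0; rewrite -(fineK Sfin) lee_fin (LP s s0).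
have : 0 < phi s + s * derive1 phi s.
  have := phi_incr phiP s0; rewrite derive1E.
  have dphi : is_derive s 1 phi (derive1 phi s).
    by rewrite derive1E; apply: DeriveDef => //; exact: phi_derivable.
  have e := is_deriveM (is_derive_id s (1 : R)) dphi.
  have -> : (fun t : R => t * phi t) = (id * phi : R -> R) by [].
  by have [_ ->] := e; rewrite /GRing.scale/= mulr1 addrC.
set d := derive1 phi s => pd0.
(* The denominator of Lambda is the sum of (s phi)' and phi, both positive, so the inequality may be
   multiplied by its square. *)
have D0 : 0 < s * d + 2 * phi s by lra.
rewrite sqrrN expr_div_n ler_pdivrMr ?exprn_gt0// => h.
by rewrite [2 * _ + _]addrC; move: h; lra.
Qed.

Theorem corollary1 (R : realType) (N m : nat) (N_gt0 : (0 < N)%N) (m_gt0 : (0 < m)%N)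
    (Omega : set 'rV[R]_N) (domOmega : domain Omega)
    (A : 'I_N -> 'I_N -> 'rV[R]_N -> 'M[R[i]]_m)
    (A_Linfty : forall h k i j, Linfty Omega (fun x => A h k x i j))
    (phi Lambda : R -> R) (phiP : phi_conditions phi)
    (LambdaP : is_Lambda phi Lambda)
    (Lambda_lt1 : (ereal_sup [set (Lambda t ^+ 2)%:E | t in [set t : R | (0 < t)%R]] < 1)%E) :
  strict_LPhi_dissipative Omega A phi <->
  exists2 kappa : R, 0 < kappa & LPhi_dissipative Omega (sub_laplacian A kappa) phi.
Proof.
have [delta delta01 elliptic] := Lambda_ellipticity phiP LambdaP Lambda_lt1.
have [oOmega _ _] := domOmega.
exact: (strict_LPhi_dissipativeP oOmega (phi_gt0 phiP) (phi_derivable phiP) delta01 elliptic).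
Qed.
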